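(* Let $\hat{\sigma}_A$ be a positive semidefinite operator on $\mathbb{C}^{d_A}$. Let $\bigoplus_{i=1}^k\mathbb{C}^{d_i^A}\subseteq\mathbb{C}^{d_A}$ and $\bigoplus_{i=1}^k\mathbb{C}^{d_i^R}\subseteq\mathbb{C}^{d_R}$ be orthogonal decompositions of subspaces, and let $\rho_{A^nR^n}$ be any purification of $(\hat{\sigma}_A)^{\otimes n}$ supported on the symmetric subspace $\mathrm{Sym}^n\big(\bigoplus_{i=1}^k\mathbb{C}^{d_i^A}\otimes\mathbb{C}^{d_i^R}\big)$. Then there exists a probability measure $\mathrm{d}\phi$ on the set of purifications $|\phi\rangle_{AR}\in\bigoplus_{i=1}^k\mathbb{C}^{d_i^A}\otimes\mathbb{C}^{d_i^R}$ of $\hat{\sigma}_A$ such that $$\rho_{A^nR^n}\leq g_{n,x}\int|\phi\rangle\langle\phi|_{AR}^{\otimes n}\,\mathrm{d}\phi,\qquad x=\sum_{i=1}^k d_i^Ad_i^R .$$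
   Context: $\bigoplus_{i=1}^k\mathbb{C}^{d_i^A}\otimes\mathbb{C}^{d_i^R}$ is viewed as a subspace of $\mathbb{C}^{d_A}\otimes\mathbb{C}^{d_R}$, and $\mathrm{Sym}^n(V)\subseteq V^{\otimes n}$ is the symmetric subspace (vectors invariant under all permutations of the $n$ factors), with $V^{\otimes n}\subseteq(\mathbb{C}^{d_A}\otimes\mathbb{C}^{d_R})^{\otimes n}\cong A^nR^n$. $g_{n,x}:=\dim\mathrm{Sym}^n(\mathbb{C}^x)=\binom{n+x-1}{n}$. A purification of a positive operator $P$ on $A$ is a rank-one positive operator on $A\otimes R$ whose partial trace over $R$ equals $P$. The inequality is in the positive semidefinite order. *)

(* Defs.v *)
From HB Require Import structures.
From mathcomp Require Import all_boot all_order all_algebra.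
From mathcomp Require Import all_classical all_reals all_analysis.
From mathcomp Require Import fingroup perm.
From mathcomp Require Import complex.
Set Implicit Arguments. Unset Strict Implicit. Unset Printing Implicit Defensive.
Import Order.TTheory GRing.Theory Num.Theory.
Local Open Scope ring_scope.

(* Vectors on a finite index set T are functions T -> R[i];
   operators are kernels T -> T -> R[i] (matrix entries). *)

Section Ops.
Variable R : rcfType.
Local Notation C := (R[i]).

Definition cinner (T : finType) (u v : T -> C) : C := \sum_x conjc (u x) * v x.

Definition orthonormal_fam (I T : finType) (e : I -> T -> C) :=
  forall p q, cinner (e p) (e q) = (p == q)%:R.

Definition op_apply (T : finType) (M : T -> T -> C) (v : T -> C) : T -> C :=
  fun x => \sum_y M x y * v y.

(* positive semidefinite: <v|M v> >= 0 for all v (in the order of R[i],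
   i.e. real and nonnegative) *)
Definition psd (T : finType) (M : T -> T -> C) :=
  forall v : T -> C, 0 <= \sum_x \sum_y conjc (v x) * M x y * v y.

Definition loewner_le (T : finType) (M N : T -> T -> C) :=
  psd (fun x y => N x y - M x y).

Definition mx_of (T : finType) (M : T -> T -> C) : 'M[C]_#|T| :=
  \matrix_(i, j) M (enum_val i) (enum_val j).

Definition outer (T : finType) (u : T -> C) : T -> T -> C :=
  fun x y => u x * conjc (u y).

Definition ptrace2 (TA TR : finType) (M : TA * TR -> TA * TR -> C) : TA -> TA -> C :=
  fun a a' => \sum_r M (a, r) (a', r).

Definition purification (TA TR : finType) (P : TA -> TA -> C)
  (rho : TA * TR -> TA * TR -> C) :=
  [/\ psd rho, \rank (mx_of rho) = 1%N & ptrace2 rho = P].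

Definition supported_on (T : finType) (rho : T -> T -> C) (S : (T -> C) -> Prop) :=
  forall v, S (op_apply rho v).

Definition tpow_op (TA : finType) (n : nat) (M : TA -> TA -> C) :
  {ffun 'I_n -> TA} -> {ffun 'I_n -> TA} -> C :=
  fun a a' => \prod_m M (a m) (a' m).

Definition tpow_outer (TA TR : finType) (n : nat) (phi : TA * TR -> C) :
  {ffun 'I_n -> TA} * {ffun 'I_n -> TR} ->
  {ffun 'I_n -> TA} * {ffun 'I_n -> TR} -> C :=
  fun X Y => \prod_m (phi (X.1 m, X.2 m) * conjc (phi (Y.1 m, Y.2 m))).

(* Subspace V = (+)_i C^{dA_i} (x) C^{dR_i} inside C^{dA} (x) C^{dR}, where
   the orthogonal embeddings (+)_i C^{dA_i} -> C^{dA}, (+)_i C^{dR_i} -> C^{dR}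
   are given by orthonormal_fam families eA, eR indexed by pairs (i, a). *)
Section Subspace.
Variables (TA TR : finType) (k : nat) (dAi dRi : 'I_k -> nat).
Variables (eA : {i : 'I_k & 'I_(dAi i)} -> TA -> C)
          (eR : {i : 'I_k & 'I_(dRi i)} -> TR -> C).

Definition Vidx := {i : 'I_k & ('I_(dAi i) * 'I_(dRi i))%type}.

Definition Vbasis (j : Vidx) : TA * TR -> C :=
  fun z => eA (Tagged (fun i => 'I_(dAi i)) (tagged j).1) z.1 *
           eR (Tagged (fun i => 'I_(dRi i)) (tagged j).2) z.2.

Definition inV (v : TA * TR -> C) :=
  exists c : Vidx -> C, v = fun z => \sum_j c j * Vbasis j z.

Definition inVn (n : nat) (psi : {ffun 'I_n -> TA * TR} -> C) :=
  exists c : {ffun 'I_n -> Vidx} -> C,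
    psi = fun x => \sum_js c js * \prod_m Vbasis (js m) (x m).

Definition perm_invariant (T : finType) (n : nat) (psi : {ffun 'I_n -> T} -> C) :=
  forall (s : 'S_n) (x : {ffun 'I_n -> T}), psi [ffun m => x (s m)] = psi x.

(* Sym^n(V), transported to A^n R^n via (AR)^n ~= A^n R^n *)
Definition inSymV (n : nat)
  (psi : {ffun 'I_n -> TA} * {ffun 'I_n -> TR} -> C) :=
  let psi' := fun x : {ffun 'I_n -> TA * TR} =>
                psi ([ffun m => (x m).1], [ffun m => (x m).2]) in
  inVn psi' /\ perm_invariant psi'.

End Subspace.
End Ops.

Definition op_integral (R : realType) (d : measure_display) (T : measurableType d)
  (P : {measure set T -> \bar R}) (X : finType) (F : T -> X -> X -> R[i]) :
  X -> X -> R[i] :=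
  fun x y => Complex (\int[P]_t @complex.Re R (F t x y)) (\int[P]_t @complex.Im R (F t x y)).

Arguments tpow_op {R TA} n M _ _.
Arguments tpow_outer {R TA TR} n phi _ _.
Arguments inSymV {R TA TR k dAi dRi} eA eR n psi.

(* Main.v *)
Require Import Defs.
From HB Require Import structures.
From mathcomp Require Import all_boot all_order all_algebra.
From mathcomp Require Import all_classical all_reals all_analysis.
From mathcomp Require Import fingroup perm.
From mathcomp Require Import complex ring lra.
Import Order.TTheory GRing.Theory Num.Theory.
Import numFieldNormedType.Exports.
Set Implicit Arguments. Unset Strict Implicit. Unset Printing Implicit Defensive.
Local Open Scope ring_scope.

(** In orthonormal coordinates the purification of sigma^(x)n is a matrix c, symmetric and
    compatible with the blocks, with c c^* = s^(x)n.  Comparing ranks block by block, s has a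
    factorization s = b b^* with b in the block space, and c = b^(x)n Y for a kernel Y on R^n
    that commutes with permutations, preserves the blocks and satisfies
    b^(x)n Y Y^* = b^(x)n.

    Let f_V = (b V)^(x)n for V a block unitary of R.  Instead of Haar measure we use the point
    tau of least Frobenius norm in the convex hull of the |f_V><f_V|: by compactness and
    Caratheodory it is a finite mixture, and by uniqueness it commutes with every 1 (x) V^(x)n.
    Polynomial identities in V extend this to every permutation equivariant, block preserving
    kernel, in particular to Y.  Hence, for T = (tau + e)^-1,
    <c, T c> = <f_1, T f_1> = tr (T tau), which is at most the dimension of the symmetric
    subspace; Cauchy-Schwarz gives |c><c| <= dim * (tau + e), and e tends to 0. *)

(** * Calculus of kernels, adjoints and tensor powers; positive semidefinite forms *)

Section Kernels.
Variable R : rcfType.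
Local Notation C := R[i].

(** The obstacle is that [Y] is in general not a tensor power, while minimality of tau only yields
    commutation with the kernels V^(x)n. Hence the passage through the commutant: whatever commutes
    with all block unitary powers also commutes with [Y]; this applies to tau and is inherited by T.
    In <c, T c> the kernel [Y] can then be moved across T to meet its adjoint, and Y Y^* fixes
    b^(x)n. The same computation with V^(x)n in place of [Y] shows that <f_V, T f_V> does not depend
    on V, so averaging it over the mixture produces the trace of T tau.

    The constant counts multisets. The value of f_V at (a, r) is the product over the slots m of the
    entries of b V at (a_m, r_m). It vanishes unless every pair lies in matching blocks, and
    otherwise depends only on the multiset of these pairs. There are x matching pairs, hence
    binomial(n + x - 1, n) multisets of size n. The shift by e is there because tau may be
    singular. *)

Definition kmul (X Y Z : finType) (A : X -> Y -> C) (B : Y -> Z -> C) : X -> Z -> C :=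
  fun x z => \sum_y A x y * B y z.

Definition kadj (X Y : finType) (A : X -> Y -> C) : Y -> X -> C :=
  fun y x => conjc (A x y).

Definition kid (X : finType) : X -> X -> C := fun x y => (x == y)%:R.

Definition tpow (n : nat) (X Y : finType) (A : X -> Y -> C) :
    {ffun 'I_n -> X} -> {ffun 'I_n -> Y} -> C :=
  fun a r => \prod_m A (a m) (r m).

Lemma kerP (X Y : Type) (A B : X -> Y -> C) : (forall x y, A x y = B x y) -> A = B.
Proof. by move=> AB; apply/funext => x; apply/funext => y. Qed.

Lemma kmulA (X Y Z W : finType) (A : X -> Y -> C) (B : Y -> Z -> C) (D : Z -> W -> C) :
  kmul A (kmul B D) = kmul (kmul A B) D.
Proof.
apply: kerP => x w; rewrite /kmul.
under eq_bigr do rewrite big_distrr.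
rewrite exchange_big; apply: eq_bigr => z _; rewrite big_distrl.
by apply: eq_bigr => y _; rewrite /= mulrA.
Qed.

Lemma sum_eq1l (X : finType) (x : X) (F : X -> C) : \sum_y (x == y)%:R * F y = F x.
Proof.
rewrite (bigD1 x)//= eqxx mul1r big1 ?addr0// => y /negbTE; rewrite eq_sym => ->.
by rewrite mul0r.
Qed.

Lemma sum_eq1r (X : finType) (x : X) (F : X -> C) : \sum_y F y * (y == x)%:R = F x.
Proof. by rewrite -[RHS]sum_eq1l; apply: eq_bigr => y _; rewrite mulrC eq_sym. Qed.

Lemma kmul1l (X Y : finType) (A : X -> Y -> C) : kmul (@kid X) A = A.
Proof. by apply: kerP => x y; rewrite /kmul /kid sum_eq1l. Qed.

Lemma kmul1r (X Y : finType) (A : X -> Y -> C) : kmul A (@kid Y) = A.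
Proof. by apply: kerP => x y; rewrite /kmul /kid sum_eq1r. Qed.

Lemma kadjK (X Y : finType) (A : X -> Y -> C) : kadj (kadj A) = A.
Proof. by apply: kerP => x y; rewrite /kadj conjcK. Qed.

Lemma kadjM (X Y Z : finType) (A : X -> Y -> C) (B : Y -> Z -> C) :
  kadj (kmul A B) = kmul (kadj B) (kadj A).
Proof.
apply: kerP => x y; rewrite /kadj /kmul rmorph_sum; apply: eq_bigr => z _.
by rewrite rmorphM mulrC.
Qed.

Lemma kadj1 (X : finType) : kadj (@kid X) = @kid X.
Proof. by apply: kerP => x y; rewrite /kadj /kid conjc_nat eq_sym. Qed.

Lemma tpowM n (X Y Z : finType) (A : X -> Y -> C) (B : Y -> Z -> C) :
  @tpow n _ _ (kmul A B) = kmul (tpow A) (tpow B).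
Proof.
apply: kerP => x y; rewrite /tpow /kmul bigA_distr_bigA.
by apply: eq_bigr => f _; rewrite big_split.
Qed.

Lemma tpow_adj n (X Y : finType) (A : X -> Y -> C) :
  @tpow n _ _ (kadj A) = kadj (tpow A).
Proof. by apply: kerP => x y; rewrite /tpow /kadj rmorph_prod. Qed.

Lemma ffun_eqE n (X : finType) (x y : {ffun 'I_n -> X}) :
  ((x == y)%:R : C) = \prod_m (x m == y m)%:R.
Proof.
have [->|neq] := eqVneq x y; first by rewrite big1// => m _; rewrite eqxx.
have [m xym] : exists m, x m != y m.
  by apply/existsP; apply: contraNT neq; rewrite negb_exists => /forallP xy;
    apply/eqP/ffunP => m; have := xy m; rewrite negbK => /eqP.
by rewrite (bigD1 m)//= (negbTE xym) mul0r.
Qed.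

Lemma tpow1 n (X : finType) : @tpow n _ _ (@kid X) = @kid _.
Proof. by apply: kerP => x y; rewrite /tpow /kid ffun_eqE. Qed.

Lemma op_applyM (X : finType) (A B : X -> X -> C) v :
  op_apply (kmul A B) v = op_apply A (op_apply B v).
Proof.
apply/funext => x; rewrite /op_apply /kmul.
under eq_bigr do rewrite big_distrl.
rewrite exchange_big; apply: eq_bigr => y _; rewrite /= big_distrr.
by apply: eq_bigr => z _; rewrite /= mulrA.
Qed.

Lemma op_apply1 (X : finType) (v : X -> C) : op_apply (@kid X) v = v.
Proof. by apply/funext => x; rewrite /op_apply /kid sum_eq1l. Qed.

Lemma cinner_apply (X : finType) (A : X -> X -> C) u v :
  cinner u (op_apply A v) = \sum_x \sum_y conjc (u x) * A x y * v y.
Proof.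
apply: eq_bigr => x _; rewrite big_distrr; apply: eq_bigr => y _.
by rewrite /= mulrA.
Qed.

Lemma cinner_adj (X : finType) (A : X -> X -> C) u v :
  cinner u (op_apply A v) = cinner (op_apply (kadj A) u) v.
Proof.
rewrite cinner_apply exchange_big; apply: eq_bigr => y _.
rewrite /op_apply rmorph_sum big_distrl; apply: eq_bigr => x _.
by rewrite rmorphM /= /kadj conjcK [_ * conjc _]mulrC.
Qed.

Lemma cinnerC (X : finType) (u v : X -> C) : cinner v u = conjc (cinner u v).
Proof.
by rewrite rmorph_sum; apply: eq_bigr => x _; rewrite rmorphM /= conjcK mulrC.
Qed.

Lemma cinner_ge0 (X : finType) (v : X -> C) : 0 <= cinner v v.
Proof. by apply: sumr_ge0 => x _; rewrite mulrC mulcJ_ge0. Qed.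

Lemma mulcJ_eq0 (z : C) : (z * conjc z == 0) = (z == 0).
Proof. by rewrite mulf_eq0 conjc_eq0 orbb. Qed.

Lemma cinner_eq0 (X : finType) (v : X -> C) : cinner v v = 0 -> forall x, v x = 0.
Proof.
move=> /eqP; rewrite psumr_eq0 => [/allP v0 x|x _]; last by rewrite mulrC mulcJ_ge0.
by have := v0 x (mem_index_enum _); rewrite implyTb mulrC mulcJ_eq0 => /eqP.
Qed.

Lemma cinnerDr (X : finType) (u v w : X -> C) :
  cinner u (fun x => v x + w x) = cinner u v + cinner u w.
Proof. by rewrite -big_split; apply: eq_bigr => x _; rewrite mulrDr. Qed.

Lemma cinnerZr (X : finType) (u v : X -> C) a :
  cinner u (fun x => a * v x) = a * cinner u v.
Proof. by rewrite big_distrr; apply: eq_bigr => x _; rewrite /= mulrCA. Qed.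

Lemma cinnerDl (X : finType) (u v w : X -> C) :
  cinner (fun x => v x + w x) u = cinner v u + cinner w u.
Proof. by rewrite -big_split; apply: eq_bigr => x _; rewrite rmorphD mulrDl. Qed.

Lemma cinnerZl (X : finType) (u v : X -> C) a :
  cinner (fun x => a * v x) u = conjc a * cinner v u.
Proof. by rewrite big_distrr; apply: eq_bigr => x _; rewrite /= rmorphM mulrA. Qed.

Lemma op_applyD (X : finType) (A : X -> X -> C) u v :
  op_apply A (fun x => u x + v x) = fun x => op_apply A u x + op_apply A v x.
Proof.
by apply/funext => x; rewrite -big_split; apply: eq_bigr => y _; rewrite mulrDr.
Qed.

Lemma op_applyZ (X : finType) (A : X -> X -> C) a v :
  op_apply A (fun x => a * v x) = fun x => a * op_apply A v x.
Proof.
by apply/funext => x; rewrite big_distrr; apply: eq_bigr => y _; rewrite /= mulrCA.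
Qed.

Lemma psdE (X : finType) (A : X -> X -> C) :
  psd A <-> forall v, 0 <= cinner v (op_apply A v).
Proof. by split=> psdA v; move: (psdA v); rewrite cinner_apply. Qed.

Lemma outer_apply (X : finType) (u v : X -> C) :
  op_apply (outer u) v = fun x => cinner u v * u x.
Proof.
apply/funext => x; rewrite /op_apply /outer big_distrl; apply: eq_bigr => y _.
by rewrite -mulrA mulrC.
Qed.

Lemma cinner_outer (X : finType) (u v : X -> C) :
  cinner v (op_apply (outer u) v) = cinner v u * conjc (cinner v u).
Proof. by rewrite outer_apply cinnerZr -cinnerC mulrC. Qed.

Lemma psd_outer (X : finType) (u : X -> C) : psd (outer u).
Proof. by apply/psdE => v; rewrite cinner_outer mulcJ_ge0. Qed.

Lemma outer_herm (X : finType) (u : X -> C) : kadj (outer u) = outer u.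
Proof. by apply: kerP => x y; rewrite /kadj /outer rmorphM /= conjcK mulrC. Qed.

Definition delta_vec (X : finType) (x : X) : X -> C := fun y => (x == y)%:R.

Lemma op_apply_delta (X : finType) (A : X -> X -> C) y :
  op_apply A (delta_vec y) = fun x => A x y.
Proof.
apply/funext => x; rewrite /op_apply /delta_vec -[RHS](sum_eq1r y).
by apply: eq_bigr => z _; rewrite eq_sym.
Qed.

Lemma cinner_delta (X : finType) x (v : X -> C) : cinner (delta_vec x) v = v x.
Proof.
by rewrite /cinner /delta_vec; under eq_bigr do rewrite conjc_nat; rewrite sum_eq1l.
Qed.

Lemma psd_diag_ge0 (X : finType) (A : X -> X -> C) x : psd A -> 0 <= A x x.
Proof. by move=> /psdE /(_ (delta_vec x)); rewrite op_apply_delta cinner_delta. Qed.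

Lemma psd_pair (X : finType) (A : X -> X -> C) x y a : psd A ->
  0 <= A x x + a * A x y + conjc a * (A y x + a * A y y).
Proof.
move=> /psdE /(_ (fun z => delta_vec x z + a * delta_vec y z)).
rewrite op_applyD op_applyZ !op_apply_delta cinnerDl cinnerZl.
by rewrite !cinnerDr !cinnerZr !cinner_delta.
Qed.

(** Polarization: the form is real at [delta_vec y + delta_vec x], which makes the imaginary parts
    of [A x y] and [A y x] opposite, and at [delta_vec y + i delta_vec x], which makes their real
    parts equal. *)
Lemma psd_herm (X : finType) (A : X -> X -> C) : psd A -> kadj A = A.
Proof.
move=> psdA; apply: kerP => x y; rewrite /kadj.
have xx := ger0_Im (psd_diag_ge0 x psdA); have yy := ger0_Im (psd_diag_ge0 y psdA).
have := ger0_Im (psd_pair y x 1 psdA).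
have := ger0_Im (psd_pair y x 'i%C psdA).
move: xx yy; case: (A x x) => a1 a2; case: (A y y) => b1 b2.
case: (A x y) => c1 c2; case: (A y x) => d1 d2 /= -> ->.
rewrite !(mul0r, mul1r, mulr0, mulr1, oppr0, addr0, add0r, subr0, sub0r, mulN1r, mulNr, opprD, opprK).
move=> e1 e2; congr Complex.
  by apply/eqP; rewrite -subr_eq0 e1.
by apply/eqP; rewrite eq_sym -subr_eq0 opprK addrC e2.
Qed.

Definition kequiv n (X Y : finType) (F : {ffun 'I_n -> X} -> {ffun 'I_n -> Y} -> C) :=
  forall (s : 'S_n) (x : {ffun 'I_n -> X}) (y : {ffun 'I_n -> Y}), F [ffun m => x (s m)] [ffun m => y (s m)] = F x y.

Lemma tpow_equiv n (X Y : finType) (F : X -> Y -> C) : kequiv (tpow (n := n) F).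
Proof.
move=> s x y; rewrite /tpow [RHS](reindex_inj (@perm_inj _ s)).
by apply: eq_bigr => k _; rewrite !ffunE.
Qed.

Lemma kmul_equiv n (X Y Z : finType) (F : {ffun 'I_n -> X} -> {ffun 'I_n -> Y} -> C)
    (G : {ffun 'I_n -> Y} -> {ffun 'I_n -> Z} -> C) :
  kequiv F -> kequiv G -> kequiv (kmul F G).
Proof.
move=> eF eG s x z; rewrite /kmul (reindex (fun y : {ffun 'I_n -> Y} => [ffun k => y (s k)])) /=.
  by apply: eq_bigr => y _; rewrite eF eG.
exists (fun y : {ffun 'I_n -> Y} => [ffun k => y ((s^-1)%g k)]) => y _; apply/ffunP => k.
  by rewrite !ffunE permKV.
by rewrite !ffunE permK.
Qed.

End Kernels.

(** * Resolvents of psd kernels and domination of a rank-one operator by a mixture *)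

Section Domination.
Variable R : rcfType.
Local Notation C := R[i].

Definition kshift (X : finType) (A : X -> X -> C) (e : C) : X -> X -> C :=
  fun x y => A x y + e * kid R x y.

Lemma kshift_apply (X : finType) (A : X -> X -> C) e v :
  op_apply (kshift A e) v = fun x => op_apply A v x + e * v x.
Proof.
apply/funext => x; rewrite /op_apply -[in e * v x](op_apply1 v) big_distrr -big_split.
by apply: eq_bigr => y _; rewrite /= mulrDl mulrA.
Qed.

Lemma kshift_inv (X : finType) (A : X -> X -> C) (e : C) : psd A -> 0 < e ->
  exists T, kmul T (kshift A e) = kid R (X := X) /\ kmul (kshift A e) T = kid R (X := X).
Proof.
move=> psdA e0; set B := kshift A e; pose M := mx_of B.
have uM : M \in unitmx.
  rewrite -row_free_unit; apply: inj_row_free => v vM.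
  (* Conjugating a left null row gives a vector with <w, (A + e) w> = 0; both <w, A w> and e <w, w>
     are nonnegative, so w = 0. *)
  pose w (x : X) := conjc (v 0 (enum_rank x)).
  have Bw0 : cinner w (op_apply B w) = 0.
    rewrite cinner_apply exchange_big big1// => y _.
    rewrite -big_distrl /= (_ : \sum_x _ = (v *m M) 0 (enum_rank y)).
      by rewrite vM mxE mul0r.
    rewrite mxE (reindex _ (onW_bij _ (@enum_val_bij X))); apply: eq_bigr => i _.
    by rewrite /w conjcK enum_valK mxE enum_rankK.
  have : cinner w w = 0.
    move: Bw0; rewrite kshift_apply cinnerDr cinnerZr => /eqP.
    rewrite paddr_eq0 ?mulr_ge0 ?cinner_ge0 ?(ltW e0)//; last exact: (psdE A).1.
    by move=> /andP[_]; rewrite mulf_eq0 gt_eqF//= => /eqP.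
  move=> /cinner_eq0 w0; apply/rowP => i; rewrite mxE.
  by apply/eqP; rewrite -conjc_eq0; have := w0 (enum_val i); rewrite /w enum_valK => ->.
pose T (x y : X) := invmx M (enum_rank x) (enum_rank y).
have inj1 (x z : X) : ((enum_rank x == enum_rank z)%:R : C) = kid R x z.
  by rewrite /kid (inj_eq enum_rank_inj).
exists T; split; apply: kerP => x z; rewrite -inj1.
  transitivity ((invmx M *m M) (enum_rank x) (enum_rank z)); last by rewrite mulVmx// mxE.
  rewrite mxE [RHS](reindex _ (onW_bij _ (@enum_rank_bij X))); apply: eq_bigr => y _.
  by rewrite /T mxE !enum_rankK.
transitivity ((M *m invmx M) (enum_rank x) (enum_rank z)); last by rewrite mulmxV// mxE.
rewrite mxE [RHS](reindex _ (onW_bij _ (@enum_rank_bij X))); apply: eq_bigr => y _.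
by rewrite /T mxE !enum_rankK.
Qed.

Lemma kinv_commute (X : finType) (A T K : X -> X -> C) :
  kmul T A = kid R (X := X) -> kmul A T = kid R (X := X) -> kmul A K = kmul K A ->
  kmul T K = kmul K T.
Proof.
move=> TA AT AK.
by rewrite -[LHS]kmul1r -AT kmulA -[kmul (kmul T K) A]kmulA -AK !kmulA TA kmul1l.
Qed.

Lemma kshift_commute (X : finType) (A K : X -> X -> C) e :
  kmul A K = kmul K A -> kmul (kshift A e) K = kmul K (kshift A e).
Proof.
move=> AK; have shl (B : X -> X -> C) :
    kmul (kshift A e) B = fun x z => kmul A B x z + e * B x z.
  apply: kerP => x z; rewrite -[in e * B x z](kmul1l B) /kmul big_distrr -big_split.
  by apply: eq_bigr => y _; rewrite /= mulrDl mulrA.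
rewrite shl AK; apply: kerP => x z.
rewrite -[in e * K x z](kmul1r K) /kmul big_distrr -big_split.
by apply: eq_bigr => y _; rewrite /= mulrDr mulrCA.
Qed.

Lemma kinv_herm (X : finType) (A T : X -> X -> C) :
  kmul T A = kid R (X := X) -> kmul A T = kid R (X := X) -> kadj A = A -> kadj T = T.
Proof.
by move=> TA AT Ah; rewrite -[kadj T]kmul1r -AT kmulA -{1}Ah -kadjM AT kadj1 kmul1l.
Qed.

(** With u = T v one has v = A u, so <v, T v> = <A u, u> = <u, A u>. *)
Lemma kinv_psd (X : finType) (A T : X -> X -> C) :
  kmul A T = kid R (X := X) -> psd A -> psd T.
Proof.
move=> AT psdA; apply/psdE => v.
rewrite -{1}[v]op_apply1 -AT op_applyM -{1}(psd_herm psdA) -cinner_adj.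
by move/psdE: psdA; apply.
Qed.

Lemma kshift_psd (X : finType) (A : X -> X -> C) e : 0 <= e -> psd A -> psd (kshift A e).
Proof.
move=> e0 /psdE psdA; apply/psdE => v.
by rewrite kshift_apply cinnerDr cinnerZr addr_ge0// mulr_ge0// cinner_ge0.
Qed.

(* With T = (A + e)^-1 one has T A = 1 - e T.  A lives on functions of q that vanish off S,
   so each diagonal entry of T A is an average over a fibre of q; the identity contributes at
   most 1 per fibre and - e T contributes at most 0. *)
Lemma trace_resolvent (X Y : finType) (q : X -> Y) (S : pred X) (A T : X -> X -> C) e :
  psd A -> 0 < e -> kmul T (kshift A e) = kid R (X := X) ->
  kmul (kshift A e) T = kid R (X := X) ->
  (forall x x', ~~ S x' -> A x x' = 0) ->
  (forall x x' x'', S x' -> S x'' -> q x' = q x'' -> A x x' = A x x'') ->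
  \sum_x kmul T A x x <= #|[pred y | [exists x, S x && (q x == y)]]|%:R.
Proof.
move=> psdA e0 TA AT AS Aq.
have TAE x x' : kmul T A x x' = kid R x x' - e * T x x'.
  rewrite -TA -[in e * T x x'](kmul1r T) /kmul big_distrr -sumrB.
  by apply: eq_bigr => y _; rewrite /= mulrDr mulrCA addrK.
pose fib y := [pred x | S x && (q x == y)].
have fibE x : S x -> kmul T A x x =
    (#|fib (q x)|%:R)^-1 * \sum_(x' in fib (q x)) kmul T A x x'.
  move=> Sx; rewrite (eq_bigr (fun=> kmul T A x x)).
    rewrite sumr_const -[kmul T A x x *+ _]mulr_natl mulKf// pnatr_eq0 -lt0n.
    by apply/card_gt0P; exists x; rewrite inE Sx eqxx.
  move=> x' /andP[Sx' /eqP qx']; apply: eq_bigr => y _; congr (_ * _).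
  exact: Aq.
rewrite (bigID S)/= [X in _ + X]big1 ?addr0; last first.
  by move=> x Sx; rewrite /kmul big1// => y _; rewrite AS ?mulr0.
rewrite (partition_big q [pred y | [exists x, S x && (q x == y)]])/=; last first.
  by move=> x Sx; apply/existsP; exists x; rewrite Sx eqxx.
rewrite -sum1_card natr_sum ler_sum// => y _.
have -> : \sum_(x | S x && (q x == y)) kmul T A x x =
   (#|fib y|%:R)^-1 * \sum_(x in fib y) \sum_(x' in fib y) kmul T A x x'.
  rewrite big_distrr; apply: eq_bigr => x /andP[Sx /eqP qx].
  by rewrite fibE// qx.
have [fib0|fib_gt0] := posnP #|fib y|; first by rewrite fib0 invr0 mul0r.
rewrite ler_pdivrMl ?ltr0n// mulr1.
under eq_bigr => x xf.
  under eq_bigr do rewrite TAE.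
  rewrite sumrB -big_distrr/=.
  rewrite (bigD1 x)//= [X in _ + X - _]big1 ?addr0; last first.
    by move=> z /andP[_]; rewrite eq_sym /kid => /negbTE ->.
  rewrite /kid eqxx; over.
rewrite sumrB sumr_const -big_distrr/= gerBl mulr_ge0 ?(ltW e0)//.
(* [T] is tested on the indicator of the fibre, which gives the sum of its entries over the
   fibre. *)
have := kinv_psd AT (kshift_psd (ltW e0) psdA) => /(_ (fun x => (x \in fib y)%:R)).
rewrite [X in 0 <= X -> _](_ : _ = \sum_(x in fib y) \sum_(x' in fib y) T x x')//.
rewrite [RHS]big_mkcond; apply: eq_bigr => x _; case: ifP => _; last first.
  by rewrite big1// => z _; rewrite conjc0 !mul0r.
rewrite [RHS]big_mkcond; apply: eq_bigr => z _; rewrite conjc1 mul1r.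
by case: ifP => _; rewrite (mulr1, mulr0).
Qed.

Lemma psd_cauchy (X : finType) (A : X -> X -> C) u v : psd A ->
  cinner u (op_apply A v) * conjc (cinner u (op_apply A v)) <=
  cinner u (op_apply A u) * cinner v (op_apply A v).
Proof.
move=> psdA; set b := cinner u (op_apply A v).
set a := cinner u (op_apply A u); set d := cinner v (op_apply A v).
have bE : cinner v (op_apply A u) = conjc b.
  by rewrite cinner_adj (psd_herm psdA) cinnerC.
have pos s t : conjc s = s -> 0 <= s * (s * a + t * b) + conjc t * (s * conjc b + t * d).
  move=> sr; move/psdE: (psdA) => /(_ (fun x => s * u x + t * v x)).
  rewrite op_applyD !op_applyZ cinnerDl !cinnerZl !cinnerDr !cinnerZr.
  by rewrite -/a -/b -/d bE sr.
have dr : conjc d = d.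
  by rewrite /d -cinnerC cinner_adj (psd_herm psdA).
have a0 : 0 <= a by move/psdE: psdA; apply.
have d0 : 0 <= d by move/psdE: psdA; apply.
have ar : conjc a = a.
  by rewrite /a -cinnerC cinner_adj (psd_herm psdA).
(* For a degenerate [v] the value [b] must vanish: otherwise the multiple of [conjc b] below gives
   the form the negative value - (a + 2). *)
have [d_eq0|d_neq0] := eqVneq d 0.
  rewrite d_eq0 mulr0; have [->|z0] := eqVneq (b * conjc b) 0 => //.
  have zr : conjc (b * conjc b) = b * conjc b by rewrite rmorphM /= conjcK mulrC.
  have := pos 1 (- ((a + 1) / (b * conjc b)) * conjc b) (conjc1 _).
  rewrite d_eq0 rmorphM rmorphN fmorph_div rmorphD rmorph1 /= conjcK zr ar.
  set z := b * conjc b in z0 *; rewrite (_ : _ + _ = - (a + 2)).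
    by rewrite oppr_ge0 real_leNgt ?realD ?ger0_real ?ltr_wpDl// .
  move: z0; rewrite /z mulf_eq0 negb_or => /andP[b0 b'0].
  by field; rewrite b0 b'0.
have d_gt0 : 0 < d by rewrite lt_def d_neq0.
(* The usual minimizer [- conjc b / d], scaled by [d] to avoid division. *)
have := pos d (- conjc b) dr; rewrite rmorphN /= conjcK.
rewrite (_ : _ + _ = d * (a * d - b * conjc b)); last by ring.
by rewrite pmulr_rge0// subr_ge0.
Qed.

Definition mixture (X : finType) (m : nat) (p : 'I_m -> C) (f : 'I_m -> X -> C) : X -> X -> C :=
  fun x y => \sum_j p j * outer (f j) x y.

Lemma mixture_apply (X : finType) m (p : 'I_m -> C) f (v : X -> C) :
  op_apply (mixture p f) v = fun x => \sum_j p j * op_apply (outer (f j)) v x.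
Proof.
apply/funext => x; rewrite /op_apply /mixture.
under eq_bigr do rewrite big_distrl.
rewrite exchange_big; apply: eq_bigr => j _; rewrite /= big_distrr.
by apply: eq_bigr => y _; rewrite /= mulrA.
Qed.

Lemma cinner_sumr (X : finType) m (u : X -> C) (f : 'I_m -> X -> C) :
  cinner u (fun x => \sum_j f j x) = \sum_j cinner u (f j).
Proof.
rewrite exchange_big; apply: eq_bigr => x _; rewrite big_distrr /=.
exact: eq_bigr.
Qed.

Lemma cinner_mixture (X : finType) m (p : 'I_m -> C) f (v : X -> C) :
  cinner v (op_apply (mixture p f) v) =
  \sum_j p j * (cinner v (f j) * conjc (cinner v (f j))).
Proof.
rewrite mixture_apply cinner_sumr; apply: eq_bigr => j _.
by rewrite cinnerZr cinner_outer.
Qed.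

Lemma mixture_psd (X : finType) m (p : 'I_m -> C) (f : 'I_m -> X -> C) :
  (forall j, 0 <= p j) -> psd (mixture p f).
Proof.
move=> p0; apply/psdE => v; rewrite cinner_mixture.
by apply: sumr_ge0 => j _; rewrite mulr_ge0// mulcJ_ge0.
Qed.

(** The order of [R[i]] is partial: the instance e = 1 already forces equal imaginary parts, and the
    rest is a real limit. The + 1 in the choice [e / (c1 + 1)] covers c = 0. *)
Lemma le_forall_eps (a b c : C) : 0 <= c ->
  (forall e : C, 0 < e -> a <= b + e * c) -> a <= b.
Proof.
move=> c0 abc; have := abc 1 ltr01; rewrite mul1r lecE => /andP[].
move: c0 abc; case: a => a1 a2; case: b => b1 b2; case: c => c1 c2.
rewrite lecE /= => /andP[/eqP -> c0] abc; rewrite addr0 => e12 _.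
rewrite e12 /=; apply/ler_addgt0Pr => e e0.
have e'0 : 0 < e / (c1 + 1) by rewrite divr_gt0// ltr_wpDl.
have := abc (e / (c1 + 1))%:C%C; rewrite ltcR => /(_ e'0).
rewrite lecE /= => /andP[_]; rewrite mul0r subr0 => /le_trans; apply.
rewrite lerD2l -mulrA ler_piMr ?(ltW e0)// ler_pdivrMl ?ltr_wpDl//.
by rewrite mulr1 lerDl.
Qed.

(** The final estimate in abstract form. [S] and [q] bound the dimension: the vectors of the mixture
    vanish off [S] and are constant on the fibres of [q] in [S]. Both the unitaries [M j] and the
    possibly non-unitary [K] are used only through commutation with the mixture and the fact that
    B^* B fixes [f0]. *)
Lemma mixture_dominates (X Y : finType) (q : X -> Y) (S : pred X) m (p : 'I_m -> C)
    (f : 'I_m -> X -> C) (M : 'I_m -> X -> X -> C) (K : X -> X -> C) (f0 : X -> C) (N : nat) :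
  (#|[pred y | [exists x, S x && (q x == y)]]| <= N)%N ->
  (forall j, 0 <= p j) -> \sum_j p j = 1 ->
  (forall j x, ~~ S x -> f j x = 0) ->
  (forall j x x', S x -> S x' -> q x = q x' -> f j x = f j x') ->
  (forall j, f j = op_apply (M j) f0) ->
  (forall j, kmul (kadj (M j)) (M j) = kid R (X := X)) ->
  (forall j, kmul (mixture p f) (M j) = kmul (M j) (mixture p f)) ->
  kmul (mixture p f) K = kmul K (mixture p f) ->
  op_apply (kmul (kadj K) K) f0 = f0 ->
  loewner_le (outer (op_apply K f0)) (fun x y => N%:R * mixture p f x y).
Proof.
move=> YN p0 p1 fS fq fM Mu Mc Kc Kf.
set A := mixture p f; set c := op_apply K f0.
have psdA : psd A by exact: mixture_psd.
apply/psdE => v.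
have -> : cinner v (op_apply (fun x y => N%:R * A x y - outer c x y) v) =
    N%:R * cinner v (op_apply A v) - cinner v c * conjc (cinner v c).
  rewrite -cinner_outer !cinner_apply big_distrr -sumrB; apply: eq_bigr => x _.
  rewrite big_distrr -sumrB; apply: eq_bigr => y _ /=; ring.
rewrite subr_ge0; apply: (@le_forall_eps _ _ (N%:R * cinner v v)).
  by rewrite mulr_ge0 ?ler0n ?cinner_ge0.
move=> e e0; have [T [TA AT]] := kshift_inv psdA e0.
have Tcomm B : kmul A B = kmul B A -> kmul T B = kmul B T.
  by move=> AB; apply: kinv_commute TA AT _; exact: kshift_commute.
have key B : kmul A B = kmul B A -> op_apply (kmul (kadj B) B) f0 = f0 ->
    cinner (op_apply B f0) (op_apply T (op_apply B f0)) = cinner f0 (op_apply T f0).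
  move=> AB Bf; rewrite -op_applyM Tcomm// op_applyM cinner_adj -op_applyM.
  by rewrite Bf.
have f0T : cinner f0 (op_apply T f0) <= N%:R.
  have <- : \sum_x kmul T A x x = cinner f0 (op_apply T f0).
    transitivity (\sum_j p j * cinner (f j) (op_apply T (f j))).
      rewrite /kmul /A /mixture.
      under eq_bigr do under eq_bigr do rewrite big_distrr.
      under eq_bigr do rewrite exchange_big.
      rewrite exchange_big; apply: eq_bigr => j _; rewrite cinner_apply big_distrr.
      apply: eq_bigr => x _; rewrite big_distrr; apply: eq_bigr => y _.
      rewrite /= /outer; ring.
    rewrite -[RHS]mul1r -p1 big_distrl; apply: eq_bigr => j _.
    by rewrite fM /= key// Mu op_apply1.
  apply: (@le_trans _ _ #|[pred y | [exists x, S x && (q x == y)]]|%:R); last by rewrite ler_nat.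
  apply: (trace_resolvent psdA e0 TA AT) => [x x' Sx'|x x' x'' S' S'' qx].
    by rewrite /A /mixture big1// => j _; rewrite /outer (fS _ _ Sx') conjc0 !mulr0.
  by apply: eq_bigr => j _; rewrite /outer (fq j _ _ S' S'' qx).
(* Cauchy-Schwarz is applied to the form of A + e at the vectors v and T c: the mixed term is <v,
   c>, and the second diagonal term is <T c, c>, that is <f0, T f0>. *)
have cE : c = op_apply (kshift A e) (op_apply T c) by rewrite -op_applyM AT op_apply1.
have shpsd := kshift_psd (ltW e0) psdA.
rewrite {1 2}cE; apply: le_trans (psd_cauchy _ _ shpsd) _.
rewrite -cE -{1}(kinv_herm TA AT (psd_herm shpsd)) -cinner_adj key//.
apply: le_trans (ler_wpM2l _ f0T) _; first by move/psdE: shpsd; apply.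
by rewrite kshift_apply cinnerDr cinnerZr mulrC mulrDr [e * (_ * _)]mulrCA.
Qed.
End Domination.

(** * Commutation with right multiplications; derivations and symmetrized tensors *)

Section Commutant.
Variable R : rcfType.
Local Notation C := R[i].

Lemma poly_nat_roots_eq0 (p : {poly C}) (w : nat -> C) :
  injective w -> (forall t, p.[w t] = 0) -> p = 0.
Proof.
move=> winj pw; apply: (@roots_geq_poly_eq0 _ p (map w (iota 0 (size p)))).
- by apply/allP => _ /mapP[t _ ->]; apply/rootP.
- by rewrite map_inj_uniq ?iota_uniq.
- by rewrite size_map size_iota.
Qed.

Variables (n : nat) (L B : finType).
Local Notation Bn := {ffun 'I_n -> B}.
Local Notation X := (L * Bn)%type.
Implicit Types (A : X -> X -> C) (K : Bn -> Bn -> C).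

(* Functions on L * Bn are L x Bn matrices; [khat K] is right multiplication by [K]. *)
Definition khat K : X -> X -> C := fun x y => (x.1 == y.1)%:R * K y.2 x.2.

Lemma sum_pair_eq (F : X -> C) l : \sum_z (z.1 == l)%:R * F z = \sum_r F (l, r).
Proof.
rewrite (eq_bigr (fun z => (z.1 == l)%:R * F (z.1, z.2))); last by case.
rewrite -(pair_bigA _ (fun l' r => (l' == l)%:R * F (l', r))) /=.
under eq_bigr do rewrite -big_distrr/=.
by rewrite -[RHS](sum_eq1l l (fun l' => \sum_r F (l', r))); apply: eq_bigr => l' _; rewrite eq_sym.
Qed.

(** The commutation relation between [A] and [khat K] entry by entry. In this form it is visibly
    linear in [K], so linear combinations and polynomial families of kernels can be treated
    directly. *)
Definition kcomm A K := forall x y,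
  \sum_r A x (y.1, r) * K y.2 r = \sum_r K r x.2 * A (x.1, r) y.

Lemma kcommP A K : kcomm A K <-> kmul A (khat K) = kmul (khat K) A.
Proof.
have l x y : kmul A (khat K) x y = \sum_r A x (y.1, r) * K y.2 r.
  rewrite -(sum_pair_eq (fun z => A x z * K y.2 z.2)); apply: eq_bigr => z _.
  rewrite /khat; ring.
have r x y : kmul (khat K) A x y = \sum_r K r x.2 * A (x.1, r) y.
  rewrite -(sum_pair_eq (fun z => K z.2 x.2 * A z y) x.1); apply: eq_bigr => z _.
  rewrite /khat [x.1 == _]eq_sym; ring.
split=> [AK|AK x y]; first by apply: kerP => x y; rewrite l r.
by rewrite -l -r AK.
Qed.

Lemma khatM K K' : khat (kmul K K') = kmul (khat K') (khat K).
Proof.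
apply: kerP => x y; rewrite {2}/kmul.
rewrite (eq_bigr (fun z => (z.1 == x.1)%:R * ((z.1 == y.1)%:R * (K' z.2 x.2 * K y.2 z.2)))); last first.
  move=> z _; rewrite /khat [x.1 == _]eq_sym; ring.
rewrite (sum_pair_eq (fun z => (z.1 == y.1)%:R * (K' z.2 x.2 * K y.2 z.2))) /= -big_distrr /=.
by rewrite /khat; congr (_ * _); apply: eq_bigr => r _; rewrite mulrC.
Qed.

Lemma khat_adj K : kadj (khat K) = khat (kadj K).
Proof. by apply: kerP => x y; rewrite /kadj /khat rmorphM /= conjc_nat eq_sym. Qed.

Lemma khat1 : khat (kid R (X := Bn)) = kid R (X := _).
Proof.
apply: kerP => -[l r] [l' r']; rewrite /khat /kid -natrM mulnb /= [r' == r]eq_sym.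
by rewrite xpair_eqE.
Qed.

Lemma khat_apply K v (l : L) (r : Bn) : op_apply (khat K) v (l, r) = \sum_r' v (l, r') * K r' r.
Proof.
rewrite -(sum_pair_eq (fun z => v z * K z.2 r)); apply: eq_bigr => z _.
rewrite /khat /= [l == _]eq_sym; ring.
Qed.

Lemma kcommM A K K' : kcomm A K -> kcomm A K' -> kcomm A (kmul K K').
Proof.
move=> /kcommP AK /kcommP AK'; apply/kcommP.
by rewrite khatM kmulA AK' -kmulA AK kmulA.
Qed.

Lemma kcomm1 A : kcomm A (kid R (X := Bn)).
Proof. by apply/kcommP; rewrite khat1 kmul1l kmul1r. Qed.

Lemma kcomm_lin A (J : finType) (P : pred J) (c : J -> C) (K : J -> Bn -> Bn -> C) :
  (forall j, P j -> kcomm A (K j)) -> kcomm A (fun r r' => \sum_(j | P j) c j * K j r r').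
Proof.
move=> AK x y.
transitivity (\sum_(j | P j) c j * \sum_r A x (y.1, r) * K j y.2 r).
  under eq_bigr do rewrite big_distrr.
  rewrite exchange_big; apply: eq_bigr => j _; rewrite big_distrr.
  by apply: eq_bigr => r _; rewrite /= mulrCA.
under eq_bigr => j Pj do rewrite AK// big_distrr.
rewrite exchange_big; apply: eq_bigr => r _; rewrite big_distrl.
by apply: eq_bigr => j _; rewrite /= mulrA.
Qed.

Lemma kcomm_sum A (J : finType) (P : pred J) (K : J -> Bn -> Bn -> C) :
  (forall j, P j -> kcomm A (K j)) -> kcomm A (fun r r' => \sum_(j | P j) K j r r').
Proof.
move=> AK; rewrite (_ : (fun _ _ => _) = fun r r' => \sum_(j | P j) 1 * K j r r').
  exact: kcomm_lin.
by apply: kerP => r r'; apply: eq_bigr => j _; rewrite mul1r.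
Qed.

Lemma kcommZ A c K : kcomm A K -> kcomm A (fun r r' => c * K r r').
Proof.
move=> AK; rewrite (_ : (fun _ _ => _) = fun r r' => \sum_(j < 1) c * K r r').
  exact: kcomm_lin.
by apply: kerP => r r'; rewrite big_ord1.
Qed.

Lemma kcommB A K K' : kcomm A K -> kcomm A K' -> kcomm A (fun r r' => K r r' - K' r r').
Proof.
move=> AK AK'.
rewrite (_ : (fun _ _ => _) = fun r r' => \sum_(b : bool) (-1) ^+ b * (if b then K' else K) r r').
  by apply: kcomm_lin => -[].
by apply: kerP => r r'; rewrite big_bool /= expr1 expr0 mul1r mulN1r addrC.
Qed.

Definition tens (F : 'I_n -> B -> B -> C) : Bn -> Bn -> C :=
  fun r r' => \prod_m F m (r m) (r' m).

Lemma tensM F G : kmul (tens F) (tens G) = tens (fun m => kmul (F m) (G m)).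
Proof.
apply: kerP => r r'; rewrite /tens /kmul bigA_distr_bigA.
by apply: eq_bigr => s _; rewrite big_split.
Qed.

Lemma tens1 : tens (fun=> kid R (X := B)) = kid R (X := Bn).
Proof. exact: tpow1. Qed.

(** The derivation action of the Lie algebra on the tensor power: [Q] in one slot, summed over the
    slots. *)
Definition dsum (Q : B -> B -> C) : Bn -> Bn -> C :=
  fun r r' => \sum_m0 tens (fun m => if m == m0 then Q else kid R (X := B)) r r'.

(** Symmetrization of a product of n kernels, left unnormalized. *)
Definition symt (F : 'I_n -> B -> B -> C) : Bn -> Bn -> C :=
  fun r r' => \sum_(s : 'S_n) tens (fun m => F (s m)) r r'.

Lemma symt_perm F (t : 'S_n) : symt (fun j => F (t j)) = symt F.
Proof.
apply: kerP => r r'; rewrite /symt [RHS](reindex_inj (mulIg t)).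
by apply: eq_bigr => s _; apply: eq_bigr => m _; rewrite permM.
Qed.

(** In the term of the permutation [s], slot [m0] carries the factor of index [s m0]; for fixed [s],
    summing over slots is therefore summing over factors. *)
Lemma symt_dsum F Q : kmul (symt F) (dsum Q) =
  fun r r' => \sum_j symt (fun j' => if j' == j then kmul (F j) Q else F j') r r'.
Proof.
apply: kerP => r r'; rewrite /kmul /symt /dsum.
under eq_bigr do rewrite big_distrl.
rewrite exchange_big [RHS]exchange_big; apply: eq_bigr => s _ /=.
under eq_bigr do rewrite big_distrr.
rewrite exchange_big [RHS](reindex_inj (@perm_inj _ s)); apply: eq_bigr => m0 _ /=.
rewrite -[LHS]/(kmul (tens (fun m => F (s m))) (tens _) r r') tensM.
apply: eq_bigr => m _; rewrite (inj_eq perm_inj); case: eqP => [->|] //.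
by rewrite kmul1r.
Qed.

Lemma dsum_lin (J : finType) (c : J -> C) (Q : J -> B -> B -> C) :
  dsum (fun q q' => \sum_j c j * Q j q q') = fun r r' => \sum_j c j * dsum (Q j) r r'.
Proof.
have tE Q' r r' m0 : tens (fun m => if m == m0 then Q' else kid R (X := B)) r r' =
    Q' (r m0) (r' m0) * \prod_(m | m != m0) kid R (r m) (r' m).
  rewrite /tens (bigD1 m0)//= eqxx; congr (_ * _).
  by apply: eq_bigr => m /negbTE ->.
apply: kerP => r r'; rewrite /dsum.
under [RHS]eq_bigr do rewrite big_distrr.
rewrite [RHS]exchange_big; apply: eq_bigr => m0 _; rewrite tE big_distrl.
by apply: eq_bigr => j _; rewrite /= tE mulrA.
Qed.

(* The kernels (1 + w Q)^(tensor n) are polynomial in w, with linear coefficient dsum Q. *)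
Lemma kcomm_dsum A Q (w : nat -> C) : injective w ->
  (forall t, kcomm A (tpow (fun q q' => kid R q q' + w t * Q q q'))) -> kcomm A (dsum Q).
Proof.
move=> winj Aw x y.
pose e (r r' : Bn) : {poly C} := \prod_m ((kid R (r m) (r' m))%:P + 'X * (Q (r m) (r' m))%:P).
have eh r r' t : (e r r').[w t] = tpow (fun q q' => kid R q q' + w t * Q q q') r r'.
  by rewrite horner_prod; apply: eq_bigr => m _; rewrite !hornerE.
have e1 r r' : (e r r')`_1 = dsum Q r r'.
  have prod_coef (I : seq 'I_n) (a b : 'I_n -> C) : uniq I ->
      (\prod_(m <- I) ((a m)%:P + 'X * (b m)%:P))`_0 = \prod_(m <- I) a m /\
      (\prod_(m <- I) ((a m)%:P + 'X * (b m)%:P))`_1 =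
      \sum_(m0 <- I) \prod_(m <- I) (if m == m0 then b m else a m).
    elim: I => [|m I IH] /=; first by rewrite !big_nil !coef1.
    move=> /andP[mI /IH[c0 c1]]; rewrite !big_cons; split.
      by rewrite coef0M c0 coefD coefC coefXM /= addr0.
    rewrite coefM big_ord_recl big_ord1 /= c1 c0 !coefD !coefC !coefXM /= coefC /=.
    rewrite addr0 add0r eqxx addrC; congr (_ + _).
      congr (_ * _); apply: eq_big_seq => m' m'I.
      by case: eqP m'I mI => [->|//] ->.
    rewrite big_distrr; apply: eq_big_seq => m0 m0I; rewrite big_cons.
    by case: eqP m0I mI => [->|//] ->.
  rewrite (prod_coef _ _ _ (index_enum_uniq _)).2; apply: eq_bigr => m0 _.
  by apply: eq_bigr => m _; case: ifP.
(* The difference of the two sides of [kcomm] at the entry (x, y), as a polynomial in w. Its linear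
   coefficient is the same difference for [dsum Q]. *)
pose p := \sum_r (A x (y.1, r))%:P * e y.2 r - \sum_r e r x.2 * (A (x.1, r) y)%:P.
have p0 : p = 0.
  apply: (poly_nat_roots_eq0 winj) => t; rewrite hornerD hornerN !horner_sum.
  apply/eqP; rewrite subr_eq0; apply/eqP.
  under eq_bigr do rewrite hornerM hornerC eh.
  by under [RHS]eq_bigr do rewrite hornerM hornerC eh; exact: Aw.
have : p`_1 = 0 by rewrite p0 coef0.
rewrite coefB !coef_sum => /eqP; rewrite subr_eq0 => /eqP.
under eq_bigr do rewrite coefCM e1.
by under [in X in _ = X -> _]eq_bigr do rewrite coefMC e1.
Qed.

End Commutant.

(** * From block unitaries to all equivariant block preserving kernels *)

Section BlockCommutant.
Variable R : rcfType.
Local Notation C := R[i].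

Lemma imaginary_unit : exists im : C, im * im = -1 /\ conjc im = - im.
Proof.
exists 'i%C; split; first by rewrite -expr2 sqr_i.
by rewrite /conjc /=; congr Complex; rewrite oppr0.
Qed.

(* w = z - 1 for the unit complex number z = (1 + it) / (1 - it) *)
Lemma unit_shifts : exists w : nat -> C, injective w /\
  forall t, w t + conjc (w t) + w t * conjc (w t) = 0.
Proof.
have [im [ii ci]] := imaginary_unit.
pose d (t : nat) : C := 1 - im * t%:R; pose d' (t : nat) : C := 1 + im * t%:R.
have dd' t : d t * d' t = 1 + t%:R ^+ 2.
  transitivity (1 - (im * im) * t%:R ^+ 2 : C); first by rewrite /d /d'; ring.
  by rewrite ii; ring.
have dd0 t : d t * d' t != 0.
  by rewrite dd' gt_eqF// ltr_pwDl ?ltr01// exprn_ge0// ler0n.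
have d0 t : d t != 0 by move: (dd0 t); rewrite mulf_eq0 negb_or => /andP[].
have d'0 t : d' t != 0 by move: (dd0 t); rewrite mulf_eq0 negb_or => /andP[].
have cd t : conjc (d t) = d' t.
  by rewrite /d rmorphB rmorph1 rmorphM /= ci conjc_nat mulNr opprK.
exists (fun t => 2 * im * t%:R / d t); split.
  move=> t s ts; have := congr1 (fun z => z + 2) ts.
  (* Injectivity is read off after adding 2, since the value becomes 2 / d, with [d] affine in its
     index. *)
  have two u : 2 * im * u%:R / d u + 2 = 2 / d u.
    by rewrite -[X in _ + X](mulfK (d0 u)) -mulrDl /d; congr (_ / _); ring.
  rewrite !two => /(mulfI _) => /(_ _) dts.
  have {}dts : d t = d s by apply: invr_inj; apply: dts; rewrite pnatr_eq0.
  have : im * t%:R = im * s%:R :> C.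
    by apply: oppr_inj; apply: (addrI 1).
  move/mulfI => /(_ _) tsE; apply/eqP; rewrite -(@eqr_nat C); apply/eqP/tsE.
  by apply: contra_eq_neq ii => ->; rewrite mul0r eq_sym oppr_eq0 oner_eq0.
move=> t; rewrite fmorph_div !rmorphM !rmorph_nat /= cd ci.
have -> : 2 * im * t%:R / d t + 2 * - im * t%:R / d' t +
    2 * im * t%:R / d t * (2 * - im * t%:R / d' t) =
    2 * im * t%:R * (d' t - d t - 2 * im * t%:R) / (d t * d' t).
  by field; rewrite d0 d'0.
by rewrite (_ : d' t - d t - _ = 0) ?mulr0 ?mul0r// /d /d'; ring.
Qed.

Variables (n : nat) (L B : finType) (I : eqType) (tb : B -> I).
Local Notation Bn := {ffun 'I_n -> B}.
Local Notation X := (L * Bn)%type.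
Implicit Types K : Bn -> Bn -> C.

Definition block (Q : B -> B -> C) := forall q q', tb q != tb q' -> Q q q' = 0.

Lemma block1 : block (kid R (X := B)).
Proof. by move=> q q'; rewrite /kid; have [->|//] := eqVneq q q'; rewrite eqxx. Qed.

Lemma blockM Q Q' : block Q -> block Q' -> block (kmul Q Q').
Proof.
move=> bQ bQ' q q'' qq; rewrite /kmul big1// => q' _.
have [e|ne] := eqVneq (tb q) (tb q'); last by rewrite bQ ?mul0r.
by rewrite bQ' ?mulr0// -e.
Qed.

Variable A : X -> X -> C.
Hypothesis unitary_comm : forall V, block V -> kmul (kadj V) V = kid R (X := B) ->
  kcomm A (tpow V).

(** For a projection P the kernel 1 + w P is unitary as soon as |1 + w| = 1, because (1 + w P)^* (1
    + w P) = 1 + (w + conj w + w conj w) P. Infinitely many such w isolate the linear term. *)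
Lemma kcomm_projection P : block P -> kadj P = P -> kmul P P = P -> kcomm A (dsum P).
Proof.
move=> bP hP PP; have [w [winj wu]] := unit_shifts.
apply: (kcomm_dsum winj) => t; apply: unitary_comm.
  by move=> q q' qq'; rewrite bP// block1// mulr0 addr0.
rewrite (_ : kadj _ = fun q q' => kid R q q' + conjc (w t) * P q q'); last first.
  apply: kerP => q q'; rewrite -[in RHS]hP -[in RHS]kadj1 /kadj.
  by rewrite rmorphD rmorphM.
apply: kerP => q q''.
transitivity (kmul (kid R (X := B)) (kid R (X := B)) q q'' + w t * kmul (kid R (X := B)) P q q''
    + conjc (w t) * kmul P (kid R (X := B)) q q'' + w t * conjc (w t) * kmul P P q q'').
  rewrite /kmul !big_distrr -!big_split; apply: eq_bigr => q' _ /=; ring.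
rewrite PP !kmul1r kmul1l.
transitivity (kid R q q'' + (w t + conjc (w t) + w t * conjc (w t)) * P q q''); first by ring.
by rewrite wu mul0r addr0.
Qed.

Definition kunit (q0 q1 : B) : B -> B -> C := fun q q' => (q == q0)%:R * (q' == q1)%:R.

(** A diagonal unit is a projection. An off-diagonal one is, by polarization, the sum over j < 4 of
    i^j / 2 times the projection onto (e_q0 + i^j e_q1) / sqrt 2; the three unwanted terms cancel
    because the sums of i^j and of i^(2j) vanish. *)
Lemma kcomm_unit q0 q1 : tb q0 = tb q1 -> kcomm A (dsum (kunit q0 q1)).
Proof.
move=> t01; have [<-|neq] := eqVneq q0 q1.
  apply: kcomm_projection.
  - move=> q q' qq'; rewrite /kunit; case: eqP => [e|]; rewrite ?mul0r// mul1r.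
    by case: eqP => // e'; rewrite e e' eqxx in qq'.
  - by apply: kerP => q q'; rewrite /kadj /kunit rmorphM /= !conjc_nat mulrC.
  - apply: kerP => q q'; rewrite /kmul /kunit (bigD1 q0)//= eqxx mulr1 mul1r.
    by rewrite big1 ?addr0// => q2 /negbTE ->; rewrite mulr0 mul0r.
have [im [ii ci]] := imaginary_unit.
pose u (j : 'I_4) : C := im ^+ j.
have uu j : u j * conjc (u j) = 1.
  by rewrite /u rmorphXn /= ci -exprMn mulrN ii opprK expr1n.
pose v j (q : B) : C := (q == q0)%:R + u j * (q == q1)%:R.
pose P j : B -> B -> C := fun q q' => 2^-1 * outer (v j) q q'.
have vv j : cinner (v j) (v j) = 2.
  rewrite /cinner (bigD1 q0)//= (bigD1 q1)/=; last by rewrite eq_sym.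
  rewrite big1; last first.
    by move=> q /andP[/negbTE e0 /negbTE e1]; rewrite /v e0 e1 mulr0 addr0 conjc0 mul0r.
  rewrite /v !eqxx [q1 == q0]eq_sym (negbTE neq) !mulr0 !mulr1 !addr0 add0r conjc1 mulr1.
  by rewrite mulrC uu.
have cP j : kcomm A (dsum (P j)).
  apply: kcomm_projection.
  - move=> q q' qq'; rewrite /P /outer /v.
    have z : (tb q != tb q0) || (tb q' != tb q0).
      by rewrite -negb_and; apply: contraNN qq' => /andP[/eqP -> /eqP ->].
    have out q2 : tb q2 != tb q0 -> (q2 == q0)%:R + u j * (q2 == q1)%:R = 0.
      move=> h; have [e|_] := eqVneq q2 q0; first by rewrite e eqxx in h.
      have [e|_] := eqVneq q2 q1; first by rewrite e t01 eqxx in h.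
      by rewrite mulr0 addr0.
    by case/orP: z => /out ->; rewrite ?conjc0 ?mul0r !mulr0.
  - apply: kerP => q q'; rewrite /kadj /P rmorphM fmorphV rmorph_nat; congr (_ * _).
    by rewrite -[RHS](congr1 (fun k => k q q') (outer_herm (v j))).
  - apply: kerP => q q'; rewrite /kmul /P.
    transitivity (2^-1 * 2^-1 * (v j q * conjc (v j q')) * cinner (v j) (v j)).
      by rewrite /cinner big_distrr; apply: eq_bigr => q2 _; rewrite /outer /=; ring.
    by rewrite vv /outer; field.
have -> : dsum (kunit q0 q1) =
    dsum (n := n) (fun q q' => \sum_(j < 4) (2^-1 * u j) * P j q q').
  congr dsum; apply: kerP => q q'; rewrite /P.
  transitivity (\sum_(j < 4) 4^-1 * (u j * ((q == q0)%:R * (q' == q0)%:R) +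
     (u j * conjc (u j)) * ((q == q0)%:R * (q' == q1)%:R) +
     u j * u j * ((q == q1)%:R * (q' == q0)%:R) +
     (u j * conjc (u j)) * u j * ((q == q1)%:R * (q' == q1)%:R))); last first.
    apply: eq_bigr => j _; rewrite /outer /v rmorphD rmorphM /= !conjc_nat.
    by field.
  have su : \sum_(j < 4) u j = 0.
    rewrite !big_ord_recl big_ord0 /u /=.
    transitivity ((1 + im) * (1 + im * im)); first by rewrite /bump /=; ring.
    by rewrite ii subrr mulr0.
  have suu : \sum_(j < 4) u j * u j = 0.
    rewrite !big_ord_recl big_ord0 /u /=.
    transitivity ((1 + im * im) * (1 + (im * im) * (im * im))); first by rewrite /bump /=; ring.
    by rewrite ii subrr mul0r.
  rewrite -big_distrr /= !big_split /=; under [X in _ + X + _ + _]eq_bigr do rewrite uu mul1r.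
  under [X in _ + X]eq_bigr do rewrite uu mul1r.
  rewrite -!big_distrl /= su suu !mul0r !addr0 add0r sumr_const card_ord -[(q == q0)%:R *+ 4]mulr_natl -mulrA.
  by rewrite mulKf// pnatr_eq0.
rewrite dsum_lin; exact: kcomm_lin.
Qed.

Lemma kcomm_block Q : block Q -> kcomm A (dsum Q).
Proof.
move=> bQ.
have -> : dsum Q = dsum (n := n) (fun q q' => \sum_(z : B * B) Q z.1 z.2 * kunit z.1 z.2 q q').
  congr dsum; apply: kerP => q q'.
  rewrite -(pair_bigA _ (fun a b => Q a b * kunit a b q q')) /=.
  rewrite -[LHS](sum_eq1l q (fun q2 => Q q2 q')); apply: eq_bigr => q2 _.
  rewrite -(sum_eq1l q' (fun q3 => Q q2 q3)) big_distrr /=; apply: eq_bigr => q3 _.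
  rewrite /kunit /=; ring.
rewrite dsum_lin.
rewrite (_ : (fun _ _ => _) = fun r r' => \sum_(z : B * B | tb z.1 == tb z.2)
    Q z.1 z.2 * dsum (kunit z.1 z.2) r r').
  by apply: kcomm_lin => z /eqP; exact: kcomm_unit.
apply: kerP => r r'; rewrite [RHS]big_mkcond; apply: eq_bigr => z _.
by case: ifP => // /negbT /bQ ->; rewrite mul0r.
Qed.

(* symt F' * dsum Q distributes Q over the n slots: the slots where F' = 1 all give back
   symt F, the others are handled by induction on the number of slots with F' <> 1. *)
Lemma kcomm_symt (J : {set 'I_n}) F : (forall j, block (F j)) ->
  (forall j, j \notin J -> F j = kid R (X := B)) -> kcomm A (symt F).
Proof.
move: {2}#|J| (erefl #|J|) => k; elim: k J F => [|k IH] J F cJ bF FJ.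
  apply: kcomm_sum => s _; rewrite (_ : (fun m => F (s m)) = fun=> kid R (X := B)).
    by rewrite tens1; exact: kcomm1.
  by apply/funext => m; apply: FJ; rewrite (cards0_eq cJ) inE.
have [j0 j0J] : exists j0, j0 \in J by apply/card_gt0P; rewrite cJ.
pose F' j := if j == j0 then kid R (X := B) else F j.
pose J' := J :\ j0.
have cJ' : #|J'| = k by move: cJ; rewrite (cardsD1 j0) j0J => -[].
have bF' j : block (F' j) by rewrite /F'; case: ifP => _; [exact: block1|exact: bF].
have F'J' j : j \notin J' -> F' j = kid R (X := B).
  by rewrite /F' !inE; case: eqP => //= _; exact: FJ.
pose G j j' := if j' == j then kmul (F' j) (F j0) else F' j'.
have GJ j : j \in J' -> kcomm A (symt (G j)).
  move=> jJ'; apply: (IH J') => // [j'|j' j'J']; rewrite /G.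
    by case: ifP => _; [exact: blockM|exact: bF'].
  by case: eqP j'J' => [->|_ /F'J' //]; rewrite jJ'.
(* Here [F' j] is the identity, so [G j] is [F] with the factors [j] and [j0] exchanged, which
   symmetrization does not see. *)
have GnJ j : j \notin J' -> symt (G j) = symt F.
  move=> jJ'; rewrite -[RHS](symt_perm _ (tperm j j0)); congr symt; apply/funext => j'.
  rewrite /G F'J'// kmul1l /F'; case: tpermP => [->|->|/eqP nj /eqP nj0].
  - by rewrite eqxx.
  - rewrite eqxx; case: eqP => [->//|/eqP nj]; rewrite FJ//.
    by move: jJ'; rewrite !inE [j == _]eq_sym nj.
  - by rewrite (negbTE nj) (negbTE nj0).
have sum_comm : kcomm A (fun r r' => \sum_j symt (G j) r r').
  by rewrite -symt_dsum; apply: kcommM; [exact: (IH J')|exact: kcomm_block].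
have c0 : (#|~: J'|%:R : C) != 0.
  by rewrite pnatr_eq0 -lt0n; apply/card_gt0P; exists j0; rewrite !inE eqxx.
rewrite (_ : symt F = fun r r' => #|~: J'|%:R^-1 *
    (\sum_j symt (G j) r r' - \sum_(j in J') symt (G j) r r')).
  by apply/kcommZ/kcommB => //; exact: kcomm_sum.
apply: kerP => r r'; rewrite (bigID (mem J'))/= addrAC subrr add0r.
rewrite (eq_bigr (fun=> symt F r r')) => [|j jJ']; last by rewrite GnJ.
rewrite (eq_bigl (mem (~: J'))); last by move=> j; rewrite !inE.
by rewrite sumr_const -[symt F r r' *+ _]mulr_natl mulKf.
Qed.

(** Averaging the expansion of [K] in products of matrix units over the permutations replaces each
    product by its [symt]. Only nonzero entries of [K] are kept, and for these every matrix unit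
    stays inside a block. *)
Lemma kcomm_equivariant K :
  (forall (s : 'S_n) (r r' : Bn), K [ffun m => r (s m)] [ffun m => r' (s m)] = K r r') ->
  (forall (r r' : Bn) m, tb (r m) != tb (r' m) -> K r r' = 0) -> kcomm A K.
Proof.
move=> Ks Kb.
have sE (s : 'S_n) (r r2 : Bn) : \prod_m ((r m == r2 (s m))%:R : C) =
    (r2 == [ffun m => r ((s^-1)%g m)])%:R.
  rewrite ffun_eqE (reindex_inj (@perm_inj _ s^-1%g)); apply: eq_bigr => m _.
  by rewrite permKV ffunE eq_sym.
rewrite (_ : K = fun r r' => \sum_(z : Bn * Bn | K z.1 z.2 != 0) (n`!%:R^-1 * K z.1 z.2) *
    symt (fun j => kunit (z.1 j) (z.2 j)) r r').
  apply: kcomm_lin => z Kz; apply: (kcomm_symt (J := [set: 'I_n]%SET)) => j; last by rewrite inE.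
  move=> q q' qq'; rewrite /kunit; case: eqP => [e|_]; last by rewrite mul0r.
  case: eqP => [e'|_]; last by rewrite mulr0.
  by move: qq' Kz; rewrite e e' => /Kb ->; rewrite eqxx.
apply: kerP => r r'.
have nf0 : (n`!%:R : C) != 0 by rewrite pnatr_eq0 -lt0n fact_gt0.
transitivity (\sum_(s : 'S_n) n`!%:R^-1 * K r r').
  by rewrite sumr_const -[_ * _ *+ _]mulr_natl card_Sn mulVKf.
rewrite [RHS]big_mkcond /= [RHS](eq_bigr (fun z => \sum_(s : 'S_n) n`!%:R^-1 * (K z.1 z.2 *
   ((z.1 == [ffun m => r ((s^-1)%g m)])%:R * (z.2 == [ffun m => r' ((s^-1)%g m)])%:R)))).
  rewrite exchange_big; apply: eq_bigr => s _; rewrite -big_distrr /=; congr (_ * _).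
  rewrite -(pair_bigA _ (fun a b => K a b * ((a == [ffun m => r ((s^-1)%g m)])%:R *
     (b == [ffun m => r' ((s^-1)%g m)])%:R))) /=.
  rewrite -(Ks s^-1%g r r').
  rewrite -[LHS](sum_eq1r _ (fun a => K a [ffun m => r' ((s^-1)%g m)])).
  apply: eq_bigr => a _.
  rewrite -(sum_eq1r _ (fun b => K a b)) big_distrl /=; apply: eq_bigr => b _; ring.
move=> z _; case: ifP => [_|/negbT]; last first.
  by rewrite negbK => /eqP ->; rewrite big1// => s _; rewrite mul0r mulr0.
rewrite /symt big_distrr; apply: eq_bigr => s _; rewrite /= -!sE -big_split.
by rewrite /= mulrA.
Qed.

End BlockCommutant.

(** * Caratheodory reduction and the point of least norm in a convex hull *)

Section ConvexHull.
Variable R : realType.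

Lemma affine_dependence (F : finType) m (x : 'I_m -> F -> R) : (#|F|.+1 < m)%N ->
  exists c : 'I_m -> R, [/\ exists j, c j != 0, \sum_j c j = 0 &
    forall y, \sum_j c j * x j y = 0].
Proof.
(* The additional coordinate [None] is constantly 1, so that a linear dependence of the extended
   vectors is an affine dependence of the [x j]. *)
move=> Fm; pose z j (o : option F) := if o is Some y then x j y else 1.
pose M : 'M[R]_(m, #|{: option F}|) := \matrix_(j, i) z j (enum_val i).
have : kermx M != 0.
  rewrite kermx_eq0; apply/negP => /eqP rM.
  have := rank_leq_col M; rewrite rM card_option leqNgt; exact/negP/negPn.
move=> /rowV0Pn[v /sub_kermxP vM v0].
have vz o : \sum_j v 0 j * z j o = 0.
  have := congr1 (fun w : 'rV[R]_ _ => w 0 (enum_rank o)) vM.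
  rewrite !mxE => vMo; rewrite -[RHS]vMo; apply: eq_bigr => j _.
  by rewrite mxE enum_rankK.
exists (v 0); split.
- apply/existsP; apply: contraNT v0; rewrite negb_exists => /forallP v0.
  by apply/eqP/rowP => j; rewrite mxE; apply/eqP; move: (v0 j); rewrite negbK.
- by rewrite -[RHS](vz None); apply: eq_bigr => j _; rewrite mulr1.
- by move=> y; exact: (vz (Some y)).
Qed.

(** Move [p] along an affine dependence [c] until the first weight reaches zero, at the least ratio
    [p j / c j] with [c j] positive. The vanishing weight keeps its index, which is then free to
    carry another point. *)
Lemma caratheodory_step (F : finType) m (x : 'I_m -> F -> R) (p : 'I_m -> R) :
  (#|F|.+1 < m)%N -> (forall j, 0 <= p j) ->
  exists p' : 'I_m -> R, [/\ forall j, 0 <= p' j, \sum_j p' j = \sum_j p j,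
    forall y, \sum_j p' j * x j y = \sum_j p j * x j y & exists j, p' j = 0].
Proof.
move=> Fm p0; have [c [[j1 cj1] csum cx]] := affine_dependence x Fm.
have [j2 cj2] : exists j, 0 < c j.
  apply/existsP; apply: contraNT cj1; rewrite negb_exists => /forallP c0.
  have c0' j : c j <= 0 by rewrite leNgt.
  have : \sum_j - c j = 0 by rewrite sumrN csum oppr0.
  move=> /eqP; rewrite psumr_eq0 => [/allP /(_ j1 (mem_index_enum _))|j _].
    by rewrite implyTb oppr_eq0.
  by rewrite oppr_ge0.
case: (@Order.TotalTheory.arg_minP _ _ _ j2 (fun j => 0 < c j) (fun j => p j / c j) cj2) => j0 cj0 minj0.
have t0 : 0 <= p j0 / c j0 by rewrite divr_ge0// ltW.
exists (fun j => p j - p j0 / c j0 * c j); split.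
- move=> j; rewrite subr_ge0; have [cj|cj] := ltP 0 (c j).
    by rewrite -ler_pdivlMr//; exact: minj0.
  by apply: le_trans (p0 j); rewrite mulr_ge0_le0.
- by rewrite sumrB -mulr_sumr csum mulr0 subr0.
- move=> y; transitivity (\sum_j p j * x j y - p j0 / c j0 * \sum_j c j * x j y); last first.
    by rewrite cx mulr0 subr0.
  rewrite mulr_sumr -sumrB; apply: eq_bigr => j _; ring.
- by exists j0; rewrite divfK ?subrr// gt_eqF.
Qed.

Lemma continuous_sum (T : topologicalType) (I : Type) (r : seq I) (P : pred I)
    (f : I -> T -> R) : (forall i, P i -> continuous (f i)) ->
  continuous (fun t => \sum_(i <- r | P i) f i t).
Proof.
move=> cf; elim: r => [|i r IH].
  rewrite (_ : (fun _ => _) = cst 0); first exact: cst_continuous.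
  by apply/funext => t; rewrite big_nil.
case: (boolP (P i)) => Pi.
  rewrite (_ : (fun _ => _) = fun t => f i t + \sum_(i <- r | P i) f i t).
    by move=> t; apply: continuousD; [exact: cf|exact: IH].
  by apply/funext => t; rewrite big_cons Pi.
by rewrite (_ : (fun _ => _) = fun t => \sum_(i <- r | P i) f i t)//;
  apply/funext => t; rewrite big_cons (negbTE Pi).
Qed.

(* A minimizer over combinations of #|F| + 2 points suffices: by Caratheodory one of the
   points is redundant, which leaves room for moving towards any other point v. *)
Lemma min_norm_hull (F : finType) (U : topologicalType) (A : set U) (phi : U -> F -> R) :
  (A !=set0)%classic -> compact A -> (forall y, continuous (fun u => phi u y)) ->
  exists m (p : 'I_m -> R) (u : 'I_m -> U),
  [/\ forall j, 0 <= p j, \sum_j p j = 1, forall j, A (u j) &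
    forall v, A v -> \sum_y (\sum_j p j * phi (u j) y) ^+ 2 <=
                     \sum_y (\sum_j p j * phi (u j) y) * phi v y].
Proof.
move=> [a Aa] cA cphi; pose m := #|F|.+2.
pose T := prod_topology (fun _ : 'I_m => (R * U)%type).
pose box := [set t : T | forall j, (`[0, 1]%classic `*` A)%classic (t j)]%classic.
pose K := (box `&` [set t : T | \sum_j (t j).1 = 1])%classic.
have c1 j : continuous (fun t : T => (t j).1).
  move=> t; apply: (@continuous_comp _ _ _ (fun t : T => t j) fst).
    exact: (@proj_continuous _ (fun _ : 'I_m => (R * U)%type) j).
  exact: cvg_fst.
have c2 j y : continuous (fun t : T => phi (t j).2 y).
  move=> t; apply: (@continuous_comp _ _ _ (fun t : T => (t j).2) (fun u => phi u y)).
    apply: (@continuous_comp _ _ _ (fun t : T => t j) snd).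
      exact: (@proj_continuous _ (fun _ : 'I_m => (R * U)%type) j).
    exact: cvg_snd.
  exact: cphi.
have cK : compact K.
  apply: compact_closedI.
    apply: (@tychonoff _ (fun _ : 'I_m => (R * U)%type) (fun _ => (`[0, 1] `*` A)%classic)) => j.
    by apply: compact_setX => //; exact: segment_compact.
  apply: (@preimage_closed T R (fun t => \sum_j (t j).1) [set x | x = 1]%classic).
    by move=> t _; apply: continuous_sum => j _; exact: c1.
  exact: closed_eq.
pose obj (t : T) := \sum_y (\sum_j (t j).1 * phi (t j).2 y) ^+ 2.
have cobj : continuous obj.
  apply: continuous_sum => y _ t.
  have c : continuous (fun t : T => \sum_j (t j).1 * phi (t j).2 y).
    apply: continuous_sum => j _ {}t.
    exact: (cvgM (c1 j t) (c2 j y t)).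
  exact: (cvgM (c t) (c t)).
have K0 : (K !=set0)%classic.
  exists (fun j => ((j == ord0)%:R, a)); split.
    move=> j; split => //=; rewrite in_itv /=.
    by case: eqP => _; rewrite ?lexx ?ler01.
  by rewrite /= (bigD1 ord0)//= big1 ?addr0// => j /negbTE ->.
have [t tK tmin] := compact_EVT_min K0 cK (continuous_subspaceT cobj).
have [tbox tsum] := set_mem tK.
have tA j : A (t j).2 by have [] := tbox j.
have t0 j : 0 <= (t j).1 by have [/=] := tbox j; rewrite in_itv => /andP[].
have [p' [p'0 p'sum p'x [j0 p'j0]]] :=
  caratheodory_step (fun j => phi (t j).2) (ltnSn _) t0.
exists m, (fun j => (t j).1), (fun j => (t j).2); split => // v Av.
pose tau y := \sum_j (t j).1 * phi (t j).2 y.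
rewrite leNgt; apply/negP => ba.
set a' := \sum_y tau y ^+ 2; set b := \sum_y tau y * phi v y; rewrite -/a' -/b in ba.
pose e := \sum_y (tau y - phi v y) ^+ 2.
have e0 : 0 <= e by apply: sumr_ge0 => y _; exact: sqr_ge0.
(* At (1 - s) tau + s phi(v) the squared norm is a' + s (s e - 2 (a' - b)), which is below a'
   whenever s is positive and s e < 2 (a' - b). The denominator ensures this together with s <= 1,
   also when e = 0. *)
pose s := (a' - b) / (a' - b + e).
have ab0 : 0 < a' - b by rewrite subr_gt0.
have abe0 : 0 < a' - b + e by rewrite ltr_wpDr.
have s0 : 0 < s by rewrite divr_gt0.
have s1 : s <= 1 by rewrite ler_pdivrMr// mul1r lerDl.
pose ts : T := fun j => if j == j0 then (s, v) else ((1 - s) * p' j, (t j).2).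
have p'0sum : \sum_(j | j != j0) p' j = 1.
  by move: p'sum; rewrite tsum (bigD1 j0)//= p'j0 add0r.
have p'le1 j : p' j <= 1.
  rewrite -tsum -p'sum (bigD1 j)//= lerDl.
  by apply: sumr_ge0.
have tsK : ts \in K.
  apply/mem_set; split.
    move=> j; rewrite /ts; case: eqP => _ /=; split => //=.
      by rewrite in_itv /= (ltW s0) s1.
    by rewrite in_itv /= mulr_ge0 ?subr_ge0// mulr_ile1// ?subr_ge0// lerBlDr lerDl ltW.
  rewrite /= (bigD1 j0)//= /ts eqxx /=.
  rewrite (eq_bigr (fun j => (1 - s) * p' j)) => [|j /negbTE ->//].
  by rewrite -mulr_sumr p'0sum mulr1 addrC subrK.
have := tmin _ tsK; rewrite /obj -/a'.
have -> : \sum_y (\sum_j (ts j).1 * phi (ts j).2 y) ^+ 2 =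
    a' + s * (s * e - 2 * (a' - b)).
  transitivity (\sum_y ((1 - s) * tau y + s * phi v y) ^+ 2).
    apply: eq_bigr => y _; congr (_ ^+ 2); rewrite (bigD1 j0)//= {1 2}/ts eqxx /= addrC.
    congr (_ + _); rewrite /tau -p'x mulr_sumr [RHS](bigD1 j0)//= p'j0 mul0r mulr0 add0r.
    by apply: eq_bigr => j /negbTE jj0; rewrite /ts jj0 /= mulrA.
  rewrite /a' /b /e !mulr_sumr -sumrB !mulr_sumr -sumrB mulr_sumr -big_split.
  by apply: eq_bigr => y _ /=; ring.
rewrite lerDl pmulr_rge0// subr_ge0 leNgt => /negP; apply.
rewrite /s mulrAC ltr_pdivrMr// mulrDr.
have := mulr_ge0 (ltW ab0) e0; have := mulr_gt0 ab0 ab0; nra.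
Qed.

End ConvexHull.

(** * Invariance of the least-norm mixture, and continuity of complex functions *)

Section InvariantMixture.
Variable R : realType.
Local Notation C := R[i].
Local Notation Re := (@complex.Re R).
Local Notation Im := (@complex.Im R).

Lemma ReD (z w : C) : Re (z + w) = Re z + Re w. Proof. by case: z w => ? ? []. Qed.
Lemma ImD (z w : C) : Im (z + w) = Im z + Im w. Proof. by case: z w => ? ? []. Qed.

Lemma Re_sum (I : Type) (r : seq I) (P : pred I) (F : I -> C) :
  Re (\sum_(i <- r | P i) F i) = \sum_(i <- r | P i) Re (F i).
Proof. exact: (big_morph Re ReD). Qed.

Lemma Im_sum (I : Type) (r : seq I) (P : pred I) (F : I -> C) :
  Im (\sum_(i <- r | P i) F i) = \sum_(i <- r | P i) Im (F i).
Proof. exact: (big_morph Im ImD). Qed.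

Lemma ReZ (p : R) z : Re (p%:C%C * z) = p * Re z.
Proof. by case: z => a b /=; rewrite mul0r subr0. Qed.

Lemma ImZ (p : R) z : Im (p%:C%C * z) = p * Im z.
Proof. by case: z => a b /=; rewrite mul0r addr0. Qed.

(** Real coordinates of a kernel, in which the Euclidean inner product is the real part of tr (A^*
    B). *)
Definition kcoord (X : finType) (A : X -> X -> C) (y : X * X * bool) : R :=
  if y.2 then Re (A y.1.1 y.1.2) else Im (A y.1.1 y.1.2).

Definition kfrob (X : finType) (A B : X -> X -> C) : R := \sum_y kcoord A y * kcoord B y.

Lemma kfrobE (X : finType) (A B : X -> X -> C) :
  kfrob A B = Re (\sum_y kmul (kadj A) B y y).
Proof.
rewrite /kfrob -(pair_bigA _ (fun x b => kcoord A (x, b) * kcoord B (x, b))) /=.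
rewrite -(pair_bigA _ (fun x y => \sum_b kcoord A (x, y, b) * kcoord B (x, y, b))) /=.
rewrite exchange_big Re_sum; apply: eq_bigr => y _; rewrite Re_sum; apply: eq_bigr => x _.
rewrite big_bool /kcoord /kadj /=; case: (A x y) => ? ?; case: (B x y) => ? ? /=.
by rewrite mulNr opprK.
Qed.

Lemma ktrace_mulC (X Y : finType) (A : X -> Y -> C) (B : Y -> X -> C) :
  \sum_x kmul A B x x = \sum_y kmul B A y y.
Proof.
by rewrite exchange_big; apply: eq_bigr => y _; apply: eq_bigr => x _; rewrite mulrC.
Qed.

Lemma mixture_conj (X : finType) m (p : 'I_m -> C) (f : 'I_m -> X -> C) (M : X -> X -> C) :
  mixture p (fun j => op_apply M (f j)) = kmul (kmul M (mixture p f)) (kadj M).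
Proof.
apply: kerP => x y; rewrite /kmul /mixture.
transitivity (\sum_j \sum_z \sum_w p j * (M x w * f j w) * (conjc (f j z) * conjc (M y z))).
  apply: eq_bigr => j _; rewrite /outer /op_apply rmorph_sum /= big_distrlr /= exchange_big.
  rewrite big_distrr; apply: eq_bigr => z _; rewrite /= big_distrr; apply: eq_bigr => w _.
  by rewrite /= rmorphM /=; ring.
rewrite exchange_big; apply: eq_bigr => z _; rewrite big_distrl exchange_big.
apply: eq_bigr => w _; rewrite /= big_distrr big_distrl; apply: eq_bigr => j _.
by rewrite /outer /kadj /=; ring.
Qed.

(** Put tau' = M tau M^*. Averaging the minimality inequality over the points M f(u_j) gives <tau,
    tau> <= <tau, tau'>, while tau' has the same norm as tau; hence the squared norm of tau - tau'
    is at most 0. A single minimizer serves all [M]. *)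
Lemma invariant_mixture (X : finType) (U : topologicalType) (A : set U) (f : U -> X -> C) :
  (A !=set0)%classic -> compact A ->
  (forall x, continuous (fun u => Re (f u x)) /\ continuous (fun u => Im (f u x))) ->
  exists m (p : 'I_m -> R) (u : 'I_m -> U),
  [/\ forall j, 0 <= p j, \sum_j p j = 1, forall j, A (u j) &
    forall M, kmul (kadj M) M = kid R (X := X) ->
      (forall v, A v -> exists2 v', A v' & f v' = op_apply M (f v)) ->
      let tau := mixture (fun j => (p j)%:C%C) (fun j => f (u j)) in
      kmul tau M = kmul M tau].
Proof.
move=> A0 cA cf.
have cphi y : continuous (fun u => kcoord (outer (f u)) y).
  case: y => -[x y] b; have [cRx cIx] := cf x; have [cRy cIy] := cf y.
  case: b; rewrite /kcoord /outer /=.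
    rewrite (_ : (fun _ => _) = fun u => Re (f u x) * Re (f u y) + Im (f u x) * Im (f u y)).
      by move=> u; exact: (cvgD (cvgM (cRx u) (cRy u)) (cvgM (cIx u) (cIy u))).
    apply/funext => u; case: (f u x) => ? ?; case: (f u y) => ? ? /=.
    by rewrite mulrN opprK.
  rewrite (_ : (fun _ => _) = fun u => Im (f u x) * Re (f u y) - Re (f u x) * Im (f u y)).
    by move=> u; exact: (cvgB (cvgM (cIx u) (cRy u)) (cvgM (cRx u) (cIy u))).
  apply/funext => u; case: (f u x) => ? ?; case: (f u y) => ? ? /=.
  by rewrite mulrN addrC.
have [m [p [u [p0 p1 uA tau_min]]]] := min_norm_hull A0 cA cphi.
exists m, p, u; split => // M Mu MA tau.
have coordE (g : 'I_m -> X -> C) y :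
    kcoord (mixture (fun j => (p j)%:C%C) g) y = \sum_j p j * kcoord (outer (g j)) y.
  rewrite /kcoord /mixture; case: y.2; rewrite ?Re_sum ?Im_sum.
    by apply: eq_bigr => j _; rewrite ReZ.
  by apply: eq_bigr => j _; rewrite ImZ.
pose tau' := mixture (fun j => (p j)%:C%C) (fun j => op_apply M (f (u j))).
have tau'E : tau' = kmul (kmul M tau) (kadj M) by exact: mixture_conj.
suff tauE : tau = tau' by rewrite {1}tauE tau'E -kmulA Mu kmul1r.
have le1 : kfrob tau tau <= kfrob tau tau'.
  have -> : kfrob tau tau' = \sum_j p j * kfrob tau (outer (op_apply M (f (u j)))).
    rewrite /kfrob; under eq_bigr do rewrite [kcoord tau' _]coordE mulr_sumr.
    rewrite exchange_big; apply: eq_bigr => j _; rewrite mulr_sumr.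
    by apply: eq_bigr => y _; rewrite mulrCA.
  rewrite -[X in X <= _]mul1r -p1 mulr_suml; apply: ler_sum => j _.
  apply: ler_wpM2l => //; have [v Av <-] := MA _ (uA j).
  move: (tau_min v Av); rewrite /kfrob.
  by under eq_bigr do rewrite -coordE; under [X in _ <= X]eq_bigr do rewrite -coordE.
have eq1 : kfrob tau' tau' = kfrob tau tau.
  rewrite !kfrobE tau'E !kadjM kadjK -!kmulA; congr Re.
  rewrite ktrace_mulC -!kmulA Mu kmul1r.
  by rewrite [X in kmul _ X]kmulA Mu kmul1l.
have d0 : \sum_y (kcoord tau y - kcoord tau' y) ^+ 2 <= 0.
  rewrite (_ : \sum_y _ = kfrob tau tau + kfrob tau' tau' - 2 * kfrob tau tau').
    by rewrite eq1; lra.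
  rewrite /kfrob mulr_sumr -big_split -sumrB; apply: eq_bigr => y _ /=; ring.
have coord_eq y : kcoord tau y = kcoord tau' y.
  have : \sum_y (kcoord tau y - kcoord tau' y) ^+ 2 == 0.
    by rewrite eq_le d0 sumr_ge0// => z _; exact: sqr_ge0.
  rewrite psumr_eq0 => [/allP /(_ y (mem_index_enum _))|z _]; last exact: sqr_ge0.
  by rewrite implyTb sqrf_eq0 subr_eq0 => /eqP.
apply: kerP => x y; have := coord_eq (x, y, true); have := coord_eq (x, y, false).
by rewrite /kcoord /=; case: (tau x y) => ? ?; case: (tau' x y) => ? ? /= -> ->.
Qed.

Definition ccont (T : topologicalType) (F : T -> C) :=
  continuous (fun t => Re (F t)) /\ continuous (fun t => Im (F t)).

Lemma ccont_cst (T : topologicalType) (c : C) : ccont (fun _ : T => c).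
Proof. by split; exact: cst_continuous. Qed.

Lemma ccontD (T : topologicalType) (F G : T -> C) :
  ccont F -> ccont G -> ccont (fun t => F t + G t).
Proof.
move=> [F1 F2] [G1 G2]; split.
  rewrite (_ : (fun _ => _) = fun t => Re (F t) + Re (G t)).
    by move=> t; exact: (cvgD (F1 t) (G1 t)).
  by apply/funext => t; rewrite ReD.
rewrite (_ : (fun _ => _) = fun t => Im (F t) + Im (G t)).
  by move=> t; exact: (cvgD (F2 t) (G2 t)).
by apply/funext => t; rewrite ImD.
Qed.

Lemma ccontM (T : topologicalType) (F G : T -> C) :
  ccont F -> ccont G -> ccont (fun t => F t * G t).
Proof.
move=> [F1 F2] [G1 G2]; split.
  rewrite (_ : (fun _ => _) = fun t => Re (F t) * Re (G t) - Im (F t) * Im (G t)).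
    by move=> t; exact: (cvgB (cvgM (F1 t) (G1 t)) (cvgM (F2 t) (G2 t))).
  by apply/funext => t; case: (F t) => ? ?; case: (G t).
rewrite (_ : (fun _ => _) = fun t => Re (F t) * Im (G t) + Im (F t) * Re (G t)).
  by move=> t; exact: (cvgD (cvgM (F1 t) (G2 t)) (cvgM (F2 t) (G1 t))).
by apply/funext => t; case: (F t) => ? ?; case: (G t).
Qed.

Lemma ccont_conj (T : topologicalType) (F : T -> C) : ccont F -> ccont (fun t => conjc (F t)).
Proof.
move=> [F1 F2]; split.
  rewrite (_ : (fun _ => _) = fun t => Re (F t))//.
  by apply/funext => t; case: (F t).
rewrite (_ : (fun _ => _) = fun t => - Im (F t)).
  by move=> t; exact: (cvgN (F2 t)).
by apply/funext => t; case: (F t).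
Qed.

Lemma ccont_sum (T : topologicalType) (I : finType) (F : I -> T -> C) :
  (forall i, ccont (F i)) -> ccont (fun t => \sum_i F i t).
Proof.
move=> cF; elim: index_enum => [|i r IH].
  rewrite (_ : (fun _ => _) = fun=> 0); first exact: ccont_cst.
  by apply/funext => t; rewrite big_nil.
rewrite (_ : (fun _ => _) = fun t => F i t + \sum_(i <- r) F i t); first exact: ccontD.
by apply/funext => t; rewrite big_cons.
Qed.

Lemma ccont_prod (T : topologicalType) (I : finType) (F : I -> T -> C) :
  (forall i, ccont (F i)) -> ccont (fun t => \prod_i F i t).
Proof.
move=> cF; elim: index_enum => [|i r IH].
  rewrite (_ : (fun _ => _) = fun=> 1); first exact: ccont_cst.
  by apply/funext => t; rewrite big_nil.
rewrite (_ : (fun _ => _) = fun t => F i t * \prod_(i <- r) F i t); first exact: ccontM.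
by apply/funext => t; rewrite big_cons.
Qed.

Lemma ccont_closed (T : topologicalType) (F : T -> C) (c : C) :
  ccont F -> closed [set t | F t = c]%classic.
Proof.
move=> [F1 F2]; rewrite (_ : [set t | _]%classic =
    ((fun t => Re (F t)) @^-1` [set x | x = Re c] `&`
     (fun t => Im (F t)) @^-1` [set x | x = Im c])%classic).
  apply: closedI.
    by apply: preimage_closed; [move=> t _; exact: F1|exact: closed_eq].
  by apply: preimage_closed; [move=> t _; exact: F2|exact: closed_eq].
rewrite predeqE => t; split => /= [->|[]] //.
by case: (F t) c => ? ? [? ?] /= -> ->.
Qed.

End InvariantMixture.

(** * Counting multisets *)

Section Counting.
Variables (Z : finType) (D : pred Z) (n : nat).

(** A multiset as its vector of multiplicities along an enumeration of [D]. A multiplicity is at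
    most n, so [inord] loses nothing. *)
Definition counts (z : 'I_n -> Z) : #|D|.-tuple 'I_n.+1 :=
  [tuple inord #|[pred m | z m == enum_val i]| | i < #|D|].

Lemma countsE z (i : 'I_#|D|) : tnth (counts z) i = #|[pred m | z m == enum_val i]| :> nat.
Proof.
rewrite tnth_mktuple inordK// ltnS -[X in (_ <= X)%N](card_ord n).
exact: max_card.
Qed.

Lemma prod_counts (R : comNzRingType) (g : Z -> R) (z z' : 'I_n -> Z) :
  (forall m, D (z m)) -> (forall m, D (z' m)) -> counts z = counts z' ->
  \prod_m g (z m) = \prod_m g (z' m).
Proof.
have prodE (w : 'I_n -> Z) : (forall m, D (w m)) ->
    \prod_m g (w m) = \prod_(i < #|D|) g (enum_val i) ^+ tnth (counts w) i.
  move=> Dw; rewrite (partition_big w D)//= (big_enum_val (A := D)) /=.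
  apply: eq_bigr => i _; rewrite countsE -prodr_const.
  by apply: eq_big => // m /eqP ->.
by move=> Dz Dz' cz; rewrite !prodE// cz.
Qed.

Lemma card_counts (X : finType) (w : X -> 'I_n -> Z) (S : pred X) : (0 < n)%N ->
  (forall x, S x -> forall m, D (w x m)) ->
  (#|[pred y | [exists x, S x && (counts (w x) == y)]]| <= 'C(n + #|D| - 1, n))%N.
Proof.
move=> n0 SD; have sumE x : S x -> (\sum_(i < #|D|) tnth (counts (w x)) i)%N = n.
  move=> /SD Dx; rewrite -[RHS]card_ord -[RHS]sum1_card [RHS](partition_big (w x) D)//=.
  rewrite [RHS](big_enum_val (A := D)) /=; apply: eq_bigr => i _.
  by rewrite countsE -sum1_card.
move: counts sumE => cnt sumE.
(* If [D] is empty, [0 < n] leaves no point in [S]. Otherwise #|D| = d + 1, and the vectors of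
   length d + 1 with sum n number binomial(d + n, d), equal to the stated coefficient. *)
case: #|D| cnt sumE => [|d] cnt sumE.
  rewrite eq_card0// => y; rewrite !inE; apply/negbTE/negP => /existsP[x /andP[/sumE]].
  by rewrite big_ord0 => n0'; rewrite -n0' in n0.
rewrite addnS subn1 /= -bin_sub ?leq_addr// addKn addnC -card_ord_partitions; apply: subset_leq_card; apply/fintype.subsetP => y.
rewrite !inE => /existsP[x /andP[/sumE sx /eqP <-]].
by rewrite big_tuple; apply/eqP.
Qed.
End Counting.

(** * Compactness of the block unitaries and the inequality in orthonormal coordinates *)

Section Core.
Variable R : realType.
Local Notation C := R[i].
Local Notation Re := (@complex.Re R).
Local Notation Im := (@complex.Im R).

Lemma kmul1C (X : finType) (A B : X -> X -> C) :
  kmul A B = kid R (X := X) -> kmul B A = kid R (X := X).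
Proof.
have mxM (F G : X -> X -> C) : mx_of (kmul F G) = mx_of F *m mx_of G.
  apply/matrixP => i j; rewrite !mxE /kmul [LHS](reindex _ (onW_bij _ (@enum_val_bij X))).
  by apply: eq_bigr => k _; rewrite !mxE.
have mx1 : mx_of (kid R (X := X)) = 1%:M.
  by apply/matrixP => i j; rewrite !mxE /kid (inj_eq enum_val_inj).
move=> AB; have : mx_of A *m mx_of B = 1%:M by rewrite -mxM AB mx1.
move=> /mulmx1C; rewrite -mxM -mx1 => /matrixP BA; apply: kerP => x y.
by have := BA (enum_rank x) (enum_rank y); rewrite !mxE !enum_rankK.
Qed.

Variables (I : eqType) (B : finType) (tb : B -> I).
Local Notation U := (prod_topology (fun _ : B * B * bool => R)).

(** The inverse of [kcoord]. Kernels become points of a product of real lines, where the block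
    unitaries form a closed subset of a cube. *)
Definition kdec (t : U) : B -> B -> C :=
  fun q q' => Complex (t (q, q', true)) (t (q, q', false)).

Lemma kcoordK (V : B -> B -> C) : kdec (kcoord V) = V.
Proof. by apply: kerP => q q'; rewrite /kdec /kcoord /=; case: (V q q'). Qed.

Lemma kdec_ccont q q' : ccont (fun t : U => kdec t q q').
Proof.
split; rewrite /kdec /=.
  exact: (@proj_continuous _ (fun _ : B * B * bool => R) (q, q', true)).
exact: (@proj_continuous _ (fun _ : B * B * bool => R) (q, q', false)).
Qed.

Definition block_unitary (V : B -> B -> C) :=
  block tb V /\ kmul (kadj V) V = kid R (X := B).

Lemma unitary_entry_le1 (V : B -> B -> C) q q' : kmul (kadj V) V = kid R (X := B) ->
  (-1 <= Re (V q q') <= 1) && (-1 <= Im (V q q') <= 1).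
Proof.
move=> VV; have := congr1 (fun K => Re (K q' q')) VV; rewrite /kid eqxx /= Re_sum => s1.
have le1 : Re (V q q') ^+ 2 + Im (V q q') ^+ 2 <= 1.
  rewrite -[X in _ <= X]s1 (bigD1 q)//= /kadj.
  have E (z : C) : Re (conjc z * z) = Re z ^+ 2 + Im z ^+ 2.
    by case: z => a b /=; rewrite mulNr opprK !expr2.
  rewrite E lerDl sumr_ge0// => q2 _; rewrite E addr_ge0 ?sqr_ge0//.
have sq (a b : R) : a ^+ 2 + b ^+ 2 <= 1 -> -1 <= a <= 1.
  by move=> ab; rewrite -ler_norml -(@ler_pXn2r _ 2) ?nnegrE// expr1n -normrX
    ger0_norm ?sqr_ge0//; apply: le_trans ab; rewrite lerDl sqr_ge0.
by rewrite (sq _ _ le1) (sq _ (Re (V q q'))) // addrC.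
Qed.

Lemma compact_block_unitary : compact [set t : U | block_unitary (kdec t)]%classic.
Proof.
apply: (@subclosed_compact _ _ [set t : U | forall y, `[-1, 1]%classic (t y)]%classic).
- rewrite (_ : [set t | _]%classic = (\bigcap_(z in [set: B * B])
    ([set t : U | kmul (kadj (kdec t)) (kdec t) z.1 z.2 = kid R z.1 z.2] `&`
     [set t : U | tb z.1 != tb z.2 -> kdec t z.1 z.2 = 0]))%classic).
    apply: closed_bigI => z _; apply: closedI.
      apply: ccont_closed; apply: ccont_sum => q; apply: ccontM; last exact: kdec_ccont.
      by apply: ccont_conj; exact: kdec_ccont.
    have [e|ne] := boolP (tb z.1 != tb z.2).
      rewrite (_ : [set t | _]%classic = [set t : U | kdec t z.1 z.2 = 0]%classic).
        exact/ccont_closed/kdec_ccont.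
      by rewrite predeqE => t; split => /= [/(_ isT)|].
    rewrite (_ : [set t | _]%classic = setT); first exact: closedT.
    by rewrite predeqE.
  rewrite predeqE => t; split => /=.
    by move=> [bt ut] z _; split => /=; [rewrite ut|exact: bt].
  move=> tz; split; first by move=> q q' qq'; have [_] := tz (q, q') Logic.I; apply.
  by apply: kerP => q q'; have [] := tz (q, q') Logic.I.
- apply: (@tychonoff _ (fun _ : B * B * bool => R) (fun _ => `[-1, 1]%classic)) => y.
  exact: segment_compact.
- move=> t [_ ut] [[q q'] b] /=; rewrite in_itv /=.
  have := unitary_entry_le1 q q' ut; rewrite /kdec /=.
  by case: b => /andP[].
Qed.

Variables (A : finType) (ta : A -> I) (n : nat).
Local Notation An := {ffun 'I_n -> A}.
Local Notation Bn := {ffun 'I_n -> B}.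

Lemma symmetric_purification_le (b : A -> B -> C) (y : B -> A -> C) (c : An -> Bn -> C) :
  (0 < n)%N ->
  (forall a r, ta a != tb r -> b a r = 0) ->
  (forall a r, ta a != tb r -> y r a = 0) ->
  (forall (s : 'S_n) (a : An) (r : Bn), c [ffun m => a (s m)] [ffun m => r (s m)] = c a r) ->
  (forall (a : An) (r : Bn) m, ta (a m) != tb (r m) -> c a r = 0) ->
  kmul b (kmul y b) = b -> kadj (kmul y b) = kmul y b ->
  kmul (tpow (kmul b y)) c = c ->
  kmul c (kadj c) = tpow (kmul b (kadj b)) ->
  exists m (p : 'I_m -> R) (V : 'I_m -> B -> B -> C),
  [/\ forall j, 0 <= p j, \sum_j p j = 1, forall j, block_unitary (V j) &
    loewner_le (outer (fun x : An * Bn => c x.1 x.2))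
      (fun x x' => 'C(n + #|[pred z : A * B | ta z.1 == tb z.2]| - 1, n)%:R *
         mixture (fun j => (p j)%:C%C)
           (fun j (x : An * Bn) => tpow (kmul b (V j)) x.1 x.2) x x')].
Proof.
move=> n0 bb yb cs cb byb ybh byc cc.
pose f (t : U) (x : An * Bn) := tpow (kmul b (kdec t)) x.1 x.2.
have cf x : continuous (fun t => Re (f t x)) /\ continuous (fun t => Im (f t x)).
  apply: ccont_prod => m; apply: ccont_sum => q.
  by apply: ccontM; [exact: ccont_cst|exact: kdec_ccont].
have ne : ([set t : U | block_unitary (kdec t)] !=set0)%classic.
  exists (kcoord (kid R (X := B))); rewrite /= kcoordK.
  by split; [exact: block1|rewrite kadj1 kmul1l].
have [m [p [u [p0 p1 uA inv]]]] := invariant_mixture ne compact_block_unitary cf.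
exists m, p, (fun j => kdec (u j)); split => //.
set tau := mixture _ _.
have hatf t K : op_apply (khat K) (f t) = fun x => kmul (tpow (kmul b (kdec t))) K x.1 x.2.
  by apply/funext => -[a r]; rewrite khat_apply.
have tauU V : block tb V -> kmul (kadj V) V = kid R (X := B) -> kcomm tau (tpow V).
  move=> bV uV; apply/kcommP; apply: inv.
    (* [khat] reverses products, so isometry of [khat] of V^(x)n asks for V V^* = 1, the other side
       of the hypothesis on [V]. *)
    by rewrite khat_adj -khatM -tpow_adj -tpowM kmul1C// tpow1 khat1.
  move=> t [bt ut]; exists (kcoord (kmul (kdec t) V)).
    rewrite /= kcoordK; split; first exact: blockM.
    by rewrite kadjM -kmulA [kmul _ (kmul _ V)]kmulA ut kmul1l.
  by rewrite hatf /f kcoordK kmulA tpowM.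
pose Y := kmul (tpow y) c.
have Ycomm : kcomm tau Y.
  apply: (kcomm_equivariant tauU) => [s r r'|r r' k rr'].
    exact: (kmul_equiv (tpow_equiv y) cs).
  rewrite /Y /kmul big1// => a _.
  have [e|ne'] := eqVneq (ta (a k)) (tb (r k)); last first.
    by rewrite /tpow (bigD1 k)//= yb// !mul0r.
  by rewrite (cb _ _ k) ?mulr0// e.
pose f0 := f (kcoord (kid R (X := B))).
have f0E : f0 = fun x => tpow b x.1 x.2 by rewrite /f0 /f kcoordK kmul1r.
have cE : (fun x : An * Bn => c x.1 x.2) = op_apply (khat Y) f0.
  by rewrite hatf kcoordK kmul1r /Y kmulA -tpowM byc.
rewrite cE.
(* The tuples whose pairs all lie in matching blocks; on them the multiset of the pairs determines
   the value of every vector of the mixture. *)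
pose S (x : An * Bn) := [forall k, ta (x.1 k) == tb (x.2 k)].
pose w (x : An * Bn) k := (x.1 k, x.2 k).
have SD x : S x -> forall k, [pred z : A * B | ta z.1 == tb z.2] (w x k).
  by move=> /forallP Sx k; exact: Sx.
apply: (mixture_dominates (q := fun x => counts [pred z : A * B | ta z.1 == tb z.2] (w x))
    (S := S) (M := fun j => khat (tpow (kdec (u j))))).
- exact: card_counts.
- by move=> j; rewrite ler0c.
- by rewrite -(rmorph_sum (real_complex R)) p1.
- move=> j x; rewrite negb_forall => /existsP[k xk].
  rewrite /tpow (bigD1 k)//= /kmul big1 ?mul0r// => q _.
  have [e|ne'] := eqVneq (ta (x.1 k)) (tb q); last by rewrite bb ?mul0r.
  by rewrite (uA j).1 ?mulr0// -e.
- move=> j x x' Sx Sx' xx'.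
  exact: (prod_counts (fun z => kmul b (kdec (u j)) z.1 z.2) (SD _ Sx) (SD _ Sx') xx').
- by move=> j; rewrite hatf kcoordK kmul1r -tpowM.
- move=> j; have [bt ut] := uA j.
  by rewrite khat_adj -khatM -tpow_adj -tpowM kmul1C// tpow1 khat1.
- by move=> j; have [bt ut] := uA j; apply/kcommP/tauU.
- exact/kcommP.
- rewrite khat_adj -khatM hatf f0E kcoordK kmul1r /Y kadjM -!kmulA.
  rewrite [kmul c _]kmulA cc -tpow_adj -!tpowM !kmulA -kmulA -kadjM ybh.
  by rewrite -!kmulA byb byb.
Qed.

End Core.

(** * Factorization of psd kernels, compatible with the blocks *)

Section Factorization.
Variable R : rcfType.
Local Notation C := R[i].

Lemma kmul_id_card (X Y : finType) (P : pred Y) (F : X -> Y -> C) :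
  (forall x y, ~~ P y -> F x y = 0) -> kmul F (kadj F) = kid R (X := X) -> (#|X| <= #|P|)%N.
Proof.
move=> FP FF; pose M : 'M[C]_(#|X|, #|P|) := \matrix_(i, j) F (enum_val i) (enum_val j).
pose N : 'M[C]_(#|P|, #|X|) := \matrix_(i, j) kadj F (enum_val i) (enum_val j).
apply: (@mulmx1_min _ _ _ M N); apply/matrixP => i j; rewrite !mxE.
transitivity (kid R (enum_val i : X) (enum_val j)); last by rewrite /kid (inj_eq enum_val_inj).
rewrite -FF /kmul (bigID P)/= [X in _ = _ + X]big1 ?addr0; last by move=> y /FP ->; rewrite mul0r.
by rewrite (big_enum_val (A := P)); apply: eq_bigr => k _; rewrite !mxE.
Qed.

Lemma psd_diag0 (X : finType) (s : X -> X -> C) x y : psd s -> s x x = 0 -> s x y = 0.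
Proof.
move=> ps sx; have := psd_cauchy (delta_vec R x) (delta_vec R y) ps.
rewrite !op_apply_delta !cinner_delta sx mul0r => le0.
by apply/eqP; rewrite -mulcJ_eq0 eq_le le0 mulcJ_ge0.
Qed.

(* Cholesky: peel off the column of a nonzero diagonal entry. *)
Lemma psd_factor (X : finType) (s : X -> X -> C) : psd s ->
  exists t (w : X -> 'I_t -> C) (z : 'I_t -> X -> C),
    kmul w (kadj w) = s /\ kmul z w = kid R (X := 'I_t).
Proof.
have [N] := ubnP #|[pred x | s x x != 0]|; elim: N s => // N IH s sN ps.
have [/existsP[k sk]|] := boolP [exists x, s x x != 0]; last first.
  rewrite negb_exists => /forallP s0.
  exists 0%N, (fun _ _ => 0), (fun _ _ => 0); split; apply: kerP => x y; last by case: x.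
  by rewrite /kmul big_ord0 psd_diag0//; apply/eqP; rewrite -[_ == _]negbK.
have sk0 : 0 <= s k k by exact: psd_diag_ge0.
have [g gr g2] : exists2 g, conjc g = g & g * g = s k k.
  exists ((Num.sqrt (complex.Re (s k k)))%:C)%C; first by rewrite conjc_real.
  rewrite -rmorphM /= -expr2 sqr_sqrtr; last by move: sk0; rewrite lecE => /andP[].
  by rewrite [RHS]complexE ger0_Im// mulr0 addr0.
have g0 : g != 0 by apply: contraNneq sk => g0; rewrite -g2 g0 mul0r.
pose w0 x := s x k / g.
have w0k : w0 k = g by rewrite /w0 -g2 mulfK.
pose s' x y := s x y - outer w0 x y.
(* Positivity of this Schur complement is Cauchy-Schwarz for [s] between [v] and [delta_vec k]. *)
have ps' : psd s'.
  apply/psdE => v.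
  have -> : cinner v (op_apply s' v) =
      cinner v (op_apply s v) - cinner v w0 * conjc (cinner v w0).
    rewrite -cinner_outer !cinner_apply -sumrB; apply: eq_bigr => x _.
    by rewrite -sumrB; apply: eq_bigr => y _; rewrite /s' mulrBr mulrBl.
  rewrite subr_ge0.
  have := psd_cauchy v (delta_vec R k) ps; rewrite op_apply_delta cinner_delta.
  have -> : cinner v (fun x => s x k) = g * cinner v w0.
    by rewrite -cinnerZr; congr cinner; apply/funext => x; rewrite /w0 mulrC divfK.
  rewrite rmorphM /= gr mulrACA g2 [X in _ <= X]mulrC ler_pM2l//.
  by rewrite lt_def sk.
have s'k : s' k k = 0 by rewrite /s' /outer w0k gr g2 subrr.
have s'N : (#|[pred x | s' x x != 0%R]| < N)%N.
  apply: leq_trans (_ : #|[pred x | s x x != 0%R]| <= N)%N => //; apply: proper_card.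
  apply/fintype.properP; split.
    apply/fintype.subsetP => x; rewrite !inE; apply: contraNneq => sx.
    by rewrite /s' /outer /w0 (psd_diag0 k ps sx) sx !mul0r subrr.
  by exists k; rewrite !inE ?sk// s'k eqxx.
have [t [w [z [ws' zw]]]] := IH s' s'N ps'.
have wk l : w k l = 0.
  have := congr1 (fun K => K k k) ws'; rewrite s'k /kmul => /eqP.
  rewrite psumr_eq0 => [/allP /(_ l (mem_index_enum _))|j _]; last exact: mulcJ_ge0.
  by rewrite implyTb mulcJ_eq0 => /eqP.
(* Row [k] of [w] vanishes, so delta_k / g pairs to 1 with [w0] and to 0 with the columns of [w]. It
   is the new dual vector, and subtracting [a l] times it makes the old [z l] annihilate [w0]. *)
pose a l := \sum_x z l x * w0 x.
exists t.+1, (fun x j => oapp (w x) (w0 x) (unlift ord0 j)),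
  (fun j x => oapp (fun l => z l x - a l * (k == x)%:R / g) ((k == x)%:R / g)
     (unlift ord0 j)).
split; apply: kerP.
  move=> x y; rewrite /kmul big_ord_recl unlift_none /=.
  under eq_bigr do rewrite /kadj liftK /=.
  have := congr1 (fun K => K x y) ws'; rewrite /kmul /s' => ->.
  by rewrite /kadj unlift_none /= addrC subrK.
have zsum (h : X -> C) : \sum_x (k == x)%:R / g * h x = h k / g.
  by rewrite -[RHS](sum_eq1l k (fun x => h x / g)); apply: eq_bigr => x _; ring.
have z2sum l (h : X -> C) : \sum_x (z l x - a l * (k == x)%:R / g) * h x =
    \sum_x z l x * h x - a l * (h k / g).
  by rewrite -zsum mulr_sumr -sumrB; apply: eq_bigr => x _; ring.
move=> i j; rewrite /kmul /kid.
case: (unliftP ord0 i) => [i' ->|->]; case: (unliftP ord0 j) => [j' ->|->] /=.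
- rewrite z2sum wk mul0r mulr0 subr0 (inj_eq lift_inj).
  exact: (congr1 (fun K => K i' j') zw).
- by rewrite z2sum w0k divff// mulr1 subrr.
- by rewrite zsum wk mul0r.
- by rewrite zsum w0k divff// eqxx.
Qed.

Variables (I A B : finType) (ta : A -> I) (tb : B -> I) (n : nat).
Local Notation An := {ffun 'I_n -> A}.
Local Notation Bn := {ffun 'I_n -> B}.

(** Each block of [s] is factored with as many columns as its rank; these columns have to be placed
    inside the corresponding block of [B]. The existence of [c] is what guarantees enough room
    there. *)
Lemma block_factorization (s : A -> A -> C) (c : An -> Bn -> C) : (0 < n)%N -> psd s ->
  (forall a a', ta a != ta a' -> s a a' = 0) ->
  (forall (a : An) (r : Bn) m, ta (a m) != tb (r m) -> c a r = 0) ->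
  kmul c (kadj c) = tpow s ->
  exists (b : A -> B -> C) (y : B -> A -> C),
  [/\ forall a r, ta a != tb r -> b a r = 0, forall a r, ta a != tb r -> y r a = 0,
    kmul b (kadj b) = s, kmul b (kmul y b) = b & kadj (kmul y b) = kmul y b].
Proof.
move=> n0 ps bs cb cc.
have fac (i : I) : exists t (w : A -> 'I_t -> C) (z : 'I_t -> A -> C),
   [/\ forall a k, ta a != i -> w a k = 0, forall a k, ta a != i -> z k a = 0,
    kmul w (kadj w) = (fun a a' => (ta a == i)%:R * s a a'), kmul z w = kid R (X := 'I_t)
    & (t <= #|[pred r | tb r == i]|)%N].
  have psi : psd (fun a a' => (ta a == i)%:R * s a a').
    move=> v; have := ps (fun a => (ta a == i)%:R * v a).
    rewrite (_ : \sum_a _ = \sum_x \sum_y conjc (v x) * ((ta x == i)%:R * s x y) * v y)//.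
    apply: eq_bigr => x _; apply: eq_bigr => y _; rewrite rmorphM /= conjc_nat.
    have [e|ne] := eqVneq (ta x) (ta y); last by rewrite (bs _ _ ne) !mulr0 !mul0r.
    by rewrite e; case: (ta y == i); rewrite !(mul1r, mul0r, mulr0).
  have [t [w [z [ws zw]]]] := psd_factor psi.
  have w0 a k : ta a != i -> w a k = 0.
    move=> ai; have := congr1 (fun K => K a a) ws.
    rewrite (negbTE ai) mul0r /kmul => /eqP.
    rewrite psumr_eq0 => [/allP /(_ k (mem_index_enum _))|j _]; last exact: mulcJ_ge0.
    by rewrite implyTb mulcJ_eq0 => /eqP.
  pose z' k a := z k a * (ta a == i)%:R.
  have z'w : kmul z' w = kid R (X := 'I_t).
    rewrite -zw; apply: kerP => k l; apply: eq_bigr => a _; rewrite /z'.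
    by have [_|ai] := boolP (ta a == i); rewrite ?mulr1// w0// !mulr0.
  exists t, w, z'; split => //.
    by move=> a k ai; rewrite /z' (negbTE ai) mulr0.
  have z's : kmul z' s = kmul z' (kmul w (kadj w)).
    rewrite ws; apply: kerP => k a; apply: eq_bigr => a' _; rewrite /z'.
    by case: (ta a' == i); rewrite !(mulr1, mulr0, mul0r, mul1r).
  (* The t^n rows of [H] are orthonormal and supported on tuples with all entries in block [i] of
     [B], so t^n is at most the n-th power of the size of that block. *)
  pose H := kmul (tpow z') c.
  have HH : kmul H (kadj H) = kid R (X := {ffun 'I_n -> 'I_t}).
    rewrite /H kadjM -kmulA [kmul c _]kmulA cc -tpow_adj -!tpowM kmulA z's.
    by rewrite kmulA z'w kmul1l -kadjM z'w kadj1 tpow1.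
  have H0 k (r : Bn) : r \notin ffun_on [pred r | tb r == i] -> H k r = 0.
    move=> /ffun_onP nr; rewrite /H /kmul big1// => a _.
    have [ai|] := boolP [forall m, ta (a m) == i]; last first.
      by rewrite negb_forall => /existsP[m am]; rewrite /tpow (bigD1 m)//= /z' (negbTE am) mulr0 !mul0r.
    have [/existsP[m rm]|] := boolP [exists m, tb (r m) != i].
      by rewrite (cb _ _ m) ?mulr0// (eqP (forallP ai m)) eq_sym.
    rewrite negb_exists => /forallP ri; exfalso; apply: nr => m.
    by rewrite inE; move: (ri m); rewrite negbK.
  have := kmul_id_card H0 HH; rewrite card_ffun_on card_ffun !card_ord.
  by rewrite leq_exp2r.
pose Fac (i : I) (t : nat) (wz : (A -> 'I_t -> C) * ('I_t -> A -> C)) :=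
   [/\ forall a k, ta a != i -> wz.1 a k = 0, forall a k, ta a != i -> wz.2 k a = 0,
    kmul wz.1 (kadj wz.1) = (fun a a' => (ta a == i)%:R * s a a'),
    kmul wz.2 wz.1 = kid R (X := 'I_t) & (t <= #|[pred r | tb r == i]|)%N].
have [h hP] : exists h : forall i, {t : nat & ((A -> 'I_t -> C) * ('I_t -> A -> C))%type},
    forall i, Fac i (projT1 (h i)) (projT2 (h i)).
  apply: (@fin_all_exists I (fun _ => {t : nat & ((A -> 'I_t -> C) * ('I_t -> A -> C))%type})
    (fun i x => Fac i (projT1 x) (projT2 x))) => i.
  have [t [w [z wz]]] := fac i.
  by exists (existT (fun t => ((A -> 'I_t -> C) * ('I_t -> A -> C))%type) t (w, z)).
pose t i := projT1 (h i).
pose K : finType := {i : I & 'I_(t i)}.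
pose w (a : A) (k : K) := (projT2 (h (tag k))).1 a (tagged k).
pose z (k : K) (a : A) := (projT2 (h (tag k))).2 (tagged k) a.
have tle i : (t i <= #|[pred r | tb r == i]|)%N by have [] := hP i.
(* An injection of the column indices into [B] respecting blocks; its matrix [Jk] satisfies Jk Jk^*
   = 1, so it carries [w] and [z] over to [B] without changing w w^* or z w. *)
pose J (k : K) : B := enum_val (widen_ord (tle (tag k)) (tagged k)).
have tJ k : tb (J k) = tag k by apply/eqP; exact: (enum_valP (widen_ord (tle (tag k)) (tagged k))).
have Jinj : injective J.
  move=> k k' JJ; have tk : tag k = tag k' by rewrite -!tJ JJ.
  case: k k' tk JJ => i k [i' k'] /= ii'; case: i' / ii' k' => k' JJ; congr existT.
  have /= := enum_val_inj JJ => /(congr1 val) /= kk.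
  exact: val_inj.
pose Jk (k : K) (r : B) : C := (J k == r)%:R.
have JJ : kmul Jk (kadj Jk) = kid R (X := K).
  apply: kerP => k k'; rewrite /kmul /Jk sum_eq1l /kadj conjc_nat /kid.
  by rewrite (inj_eq Jinj) eq_sym.
have w0 a k : ta a != tag k -> w a k = 0 by move=> ak; have [h1 _ _ _ _] := hP (tag k); exact: h1.
have z0 a k : ta a != tag k -> z k a = 0 by move=> ak; have [_ h2 _ _ _] := hP (tag k); exact: h2.
have zw : kmul z w = kid R (X := K).
  apply: kerP => -[i k] [i' k']; have [ii'|ii'] := eqVneq i i'; last first.
    rewrite /kid (_ : (_ == _) = false).
      rewrite /kmul big1// => a _; have [e|ne] := eqVneq (ta a) i.
        by rewrite w0 ?mulr0 //= e.
      by rewrite z0 ?mul0r.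
    by apply/eqP => e; move: ii'; rewrite (congr1 tag e : i = i') eqxx.
  case: i' / ii' k' => k'; have [_ _ _ + _] := hP i => /(congr1 (fun F => F k k')) /=.
  rewrite /kid => e; rewrite -[LHS]/(kmul (projT2 (h i)).2 (projT2 (h i)).1 k k') e.
  by rewrite eq_Tagged.
have ww : kmul w (kadj w) = s.
  apply: kerP => a a'; rewrite -[RHS](sum_eq1l (ta a) (fun i => s a a')).
  transitivity (\sum_i \sum_(k < t i) w a (Tagged (fun i => 'I_(t i)) k) * kadj w (Tagged (fun i => 'I_(t i)) k) a').
    by rewrite sig_big_dep; apply: eq_bigr => -[i k].
  apply: eq_bigr => i _; have [_ _ + _ _] := hP i.
  by move=> /(congr1 (fun F => F a a')).
exists (kmul w Jk), (kmul (kadj Jk) z); split.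
- move=> a r ar; rewrite /kmul big1// => k _; rewrite /Jk.
  have [e|_] := eqVneq (J k) r; last by rewrite mulr0.
  by rewrite w0 ?mul0r// -tJ e.
- move=> a r ar; rewrite /kmul big1// => k _; rewrite /kadj /Jk.
  have [e|_] := eqVneq (J k) r; last by rewrite conjc0 mul0r.
  by rewrite z0 ?mulr0// -tJ e.
- by rewrite kadjM -kmulA [kmul Jk _]kmulA JJ kmul1l.
- by rewrite -!kmulA [kmul z _]kmulA zw kmul1l [kmul Jk _]kmulA JJ kmul1l.
- by rewrite -kmulA [kmul z _]kmulA zw kmul1l kadjM kadjK.
Qed.

End Factorization.

(** * Finite mixtures of Dirac masses on [nat] *)

Section DiscreteProbability.
Variables (R : realType) (m : nat) (p : nat -> {nonneg R}).
Hypothesis p1 : \sum_(j < m) (p j)%:num = 1.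

(* [p1] occurs in the term so that the probability structure can be inferred from it. *)
Definition dirac_mix := let _ := p1 in msum (fun k => mscale (p k) (@dirac _ nat k R)) m.

HB.instance Definition _ := Measure.on dirac_mix.

Lemma dirac_mix_setT : dirac_mix setT = 1%E.
Proof.
rewrite /dirac_mix /msum /= -[RHS]/(1%R%:E) -p1 -sumEFin; apply: eq_bigr => j _.
by rewrite /mscale /= diracT mule1.
Qed.

HB.instance Definition _ := @Measure_isProbability.Build _ _ R dirac_mix dirac_mix_setT.

Lemma Rintegral_dirac_mix (f : nat -> R) :
  (\int[dirac_mix]_t f t)%R = \sum_(j < m) (p j)%:num * f j.
Proof.
have ge0E (g : nat -> \bar R) : (forall x, 0 <= g x)%E ->
    (\int[dirac_mix]_t g t = \sum_(j < m) (p j)%:num%:E * g j)%E.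
  move=> g0; rewrite /dirac_mix ge0_integral_measure_sum//=.
  apply: eq_bigr => i _.
  by rewrite ge0_integral_mscale//= integral_dirac//= diracT mul1e.
rewrite /Rintegral integralE !ge0E//.
rewrite (eq_bigr (fun j : 'I_m => ((p j)%:num * Num.max (f j) 0)%:E)); last first.
  by move=> j _; rewrite funeposE -EFin_max -EFinM.
rewrite [X in (_ - X)%E](eq_bigr (fun j : 'I_m => ((p j)%:num * Num.max (- f j) 0)%:E)); last first.
  by move=> j _; rewrite funenegE -EFinN -EFin_max -EFinM.
rewrite !sumEFin -EFinB /= -sumrB; apply: eq_bigr => j _.
rewrite -mulrBr; congr (_ * _).
have [f0|f0] := leP 0 (f j).
  by rewrite (max_idPr _) ?oppr_le0// subr0.
by rewrite (max_idPl _) ?oppr_ge0 ?(ltW f0)// sub0r opprK.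
Qed.

End DiscreteProbability.

(** * Rank-one operators, tensor powers of psd kernels, transport of the Loewner order *)

Section Transport.
Variable R : realType.
Local Notation C := R[i].

Lemma rank_outer (X : finType) (u : X -> C) x : u x != 0 -> \rank (mx_of (outer u)) = 1%N.
Proof.
move=> ux; pose c : 'cV[C]_#|X| := \col_i u (enum_val i).
pose r : 'rV[C]_#|X| := \row_i conjc (u (enum_val i)).
have E : mx_of (outer u) = c *m r.
  by apply/matrixP => i j; rewrite !mxE big_ord1 !mxE.
apply/eqP; rewrite eqn_leq; apply/andP; split.
  by rewrite E; apply: leq_trans (mxrankM_maxl _ _) _; exact: rank_leq_col.
rewrite lt0n mxrank_eq0; apply/eqP => /matrixP /(_ (enum_rank x) (enum_rank x)).
by rewrite !mxE !enum_rankK => /eqP; rewrite mulcJ_eq0 (negbTE ux).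
Qed.

(** The vector [v] exhibits [u] in the range of [M], which is where a support hypothesis on [M]
    gives information. The number t of columns is at most the rank because z M z^* is the
    identity. *)
Lemma psd_rank1 (X : finType) (M : X -> X -> C) : psd M -> \rank (mx_of M) = 1%N ->
  exists u v, M = outer u /\ u = op_apply M v /\ exists x, u x != 0.
Proof.
move=> /psd_factor[t [w [z [wM zw]]]] rM.
have t1 : (t <= 1)%N.
  rewrite -rM.
  pose Z : 'M[C]_(t, #|X|) := \matrix_(i, j) z i (enum_val j).
  pose Z' : 'M[C]_(#|X|, t) := \matrix_(i, j) kadj z (enum_val i) j.
  apply: (@mulmx1_min_rank _ _ _ _ _ Z Z'); apply/matrixP => i j.
  transitivity (kmul (kmul z M) (kadj z) i j).
    rewrite !mxE /kmul [RHS](reindex _ (onW_bij _ (@enum_val_bij X))).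
    apply: eq_bigr => k _; rewrite !mxE; congr (_ * _).
    rewrite [RHS](reindex _ (onW_bij _ (@enum_val_bij X))).
    by apply: eq_bigr => l _; rewrite !mxE.
  by rewrite -wM kmulA zw kmul1l -kadjM zw kadj1 mxE.
case: t t1 w z wM zw => [|[|//]] _ w z wM zw.
  have : \rank (mx_of M) = 0%N.
    apply/eqP; rewrite mxrank_eq0 -wM; apply/eqP/matrixP => i j.
    by rewrite !mxE /kmul big_ord0.
  by rewrite rM.
have ME : M = outer (fun x => w x ord0).
  by rewrite -wM; apply: kerP => x y; rewrite /kmul big_ord1.
have zw1 : \sum_x z ord0 x * w x ord0 = 1 := congr1 (fun K => K ord0 ord0) zw.
exists (fun x => w x ord0), (fun x => conjc (z ord0 x)); split=> //; split.
  rewrite ME outer_apply; apply/funext => x.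
  rewrite (_ : cinner _ _ = 1) ?mul1r// -(conjc1 R) -zw1 rmorph_sum.
  by apply: eq_bigr => y _; rewrite rmorphM /= mulrC.
apply/existsP; apply: contraNT (oner_neq0 C); rewrite negb_exists => /forallP w0.
by rewrite -zw1 big1// => x _; have := w0 x; rewrite negbK => /eqP ->; rewrite mulr0.
Qed.

Lemma kmul_adj_eq0 (X Y : finType) (F : X -> Y -> C) x :
  kmul F (kadj F) x x = 0 -> forall y, F x y = 0.
Proof.
move=> /eqP; rewrite psumr_eq0 => [/allP F0 y|y _]; last exact: mulcJ_ge0.
by have := F0 y (mem_index_enum _); rewrite implyTb mulcJ_eq0 => /eqP.
Qed.

(* D := G c - c satisfies D D^* = 0. *)
Lemma kmul_fix (X Y : finType) (G : X -> X -> C) (c : X -> Y -> C) :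
  kmul G (kmul c (kadj c)) = kmul c (kadj c) -> kmul G c = c.
Proof.
move=> Gcc; pose D x y := kmul G c x y - c x y.
have kmulBl (Z : finType) (F : Y -> Z -> C) :
    kmul D F = fun x z => kmul (kmul G c) F x z - kmul c F x z.
  by apply: kerP => x z; rewrite /kmul -sumrB; apply: eq_bigr => y _; rewrite mulrBl.
have DD x : kmul D (kadj D) x x = 0.
  rewrite kmulBl -kmulA; apply/eqP; rewrite subr_eq0; apply/eqP.
  have -> : kmul c (kadj D) = kadj (kmul D (kadj c)) by rewrite kadjM kadjK.
  rewrite kmulBl -kmulA Gcc.
  rewrite (_ : kadj _ = fun _ _ => 0); last by apply: kerP => a b; rewrite /kadj subrr conjc0.
  by rewrite /kmul big1// => a _; rewrite mulr0.
by apply: kerP => x y; apply/eqP; rewrite -subr_eq0; apply/eqP/(kmul_adj_eq0 (DD x)).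
Qed.

(** Entrywise, n-th powers leave roots of unity undetermined. Diagonal entries are nonnegative,
    hence equal; [F x y] is then found from the entry at (x, ..., x) and (y, x, ..., x), which is
    [F x y] times a power of [F x x]. If [F x x] is 0, the whole row vanishes. *)
Lemma tpow_psd_inj n (X : finType) (F G : X -> X -> C) : (0 < n)%N -> psd F -> psd G ->
  tpow (n := n) F = tpow G -> F = G.
Proof.
case: n => // n _ pF pG FG.
have cst x y : F x y ^+ n.+1 = G x y ^+ n.+1.
  have := congr1 (fun K => K [ffun=> x] [ffun=> y]) FG; rewrite /tpow.
  under eq_bigr do rewrite !ffunE; under [X in _ = X -> _]eq_bigr do rewrite !ffunE.
  by rewrite !prodr_const card_ord.
have diag x : F x x = G x x.
  by apply: (pexpIrn (ltn0Sn n)) (cst x x); rewrite nnegrE; exact: psd_diag_ge0.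
apply: kerP => x y; have [Fx|Fx] := eqVneq (F x x) 0.
  by rewrite (psd_diag0 y pF Fx) (psd_diag0 y pG)// -diag.
have := congr1 (fun K => K [ffun=> x] [ffun m : 'I_n.+1 => if m == ord0 then y else x]) FG.
rewrite /tpow !big_ord_recl !ffunE /=.
under eq_bigr do rewrite !ffunE /=; under [X in _ = _ * X -> _]eq_bigr do rewrite !ffunE /=.
by rewrite !prodr_const card_ord -diag => /mulIf; apply; rewrite expf_neq0.
Qed.

Lemma psd_gram (X Y : finType) (G : X -> Y -> C) : psd (kmul G (kadj G)).
Proof.
move=> v; rewrite (_ : \sum_x _ = \sum_y (\sum_x conjc (v x) * G x y) *
    conjc (\sum_x conjc (v x) * G x y)).
  by apply: sumr_ge0 => y _; exact: mulcJ_ge0.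
under [RHS]eq_bigr do rewrite rmorph_sum big_distrlr.
rewrite [RHS]exchange_big; apply: eq_bigr => x _; rewrite [RHS]exchange_big.
apply: eq_bigr => x' _; rewrite /kmul big_distrr big_distrl; apply: eq_bigr => y _.
by rewrite /= rmorphM /= conjcK /kadj; ring.
Qed.

Lemma psd_conjugate (X Y : finType) (M : X -> X -> C) (F : Y -> X -> C) :
  psd M -> psd (kmul F (kmul M (kadj F))).
Proof.
move=> /psd_factor[t [w [_ [<- _]]]]; rewrite -kmulA -kadjM kmulA; exact: psd_gram.
Qed.

Lemma tpow_outerE (X Y : finType) n (F : X -> Y -> C) (phi : X * Y -> C) :
  (forall z, phi z = F z.1 z.2) ->
  tpow_outer n phi = outer (fun x => tpow F x.1 x.2).
Proof.
move=> phiE; apply: kerP => x y; rewrite /tpow_outer /outer /tpow rmorph_prod -big_split.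
by apply: eq_bigr => m _; rewrite !phiE.
Qed.

Lemma cinner_sandwich (X Y X' Y' : finType) (P : X -> X' -> C) (Q : Y' -> Y -> C)
    (v : X * Y -> C) (c : X' -> Y' -> C) :
  cinner v (fun x => kmul P (kmul c Q) x.1 x.2) =
  cinner (fun x' => \sum_x v x * conjc (P x.1 x'.1 * Q x'.2 x.2)) (fun x' => c x'.1 x'.2).
Proof.
transitivity (\sum_x \sum_(x' : X' * Y') conjc (v x) * (P x.1 x'.1 * Q x'.2 x.2) * c x'.1 x'.2).
  apply: eq_bigr => x _; rewrite /kmul big_distrr /=.
  rewrite -(pair_bigA _ (fun a r => conjc (v x) * (P x.1 a * Q r x.2) * c a r)) /=.
  apply: eq_bigr => a _; rewrite /= !big_distrr; apply: eq_bigr => r _ /=; ring.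
rewrite exchange_big; apply: eq_bigr => x' _; rewrite rmorph_sum big_distrl.
by apply: eq_bigr => x _; rewrite /= rmorphM /= conjcK.
Qed.

(** The map c -> P c Q is linear, so testing the new inequality at [v] is testing the given one at
    the image of [v] under the adjoint map. *)
Lemma loewner_sandwich (X Y X' Y' : finType) (P : X -> X' -> C) (Q : Y' -> Y -> C)
    (c : X' -> Y' -> C) m (p : 'I_m -> C) (f : 'I_m -> X' -> Y' -> C) (N : C) :
  loewner_le (outer (fun x : X' * Y' => c x.1 x.2))
    (fun x x' => N * mixture p (fun j x => f j x.1 x.2) x x') ->
  loewner_le (outer (fun x : X * Y => kmul P (kmul c Q) x.1 x.2))
    (fun x x' => N * mixture p (fun j x => kmul P (kmul (f j) Q) x.1 x.2) x x').
Proof.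
have E (Z : finType) (u : Z -> C) (g : 'I_m -> Z -> C) v :
    cinner v (op_apply (fun x y => N * mixture p g x y - outer u x y) v) =
    N * (\sum_j p j * (cinner v (g j) * conjc (cinner v (g j)))) -
    cinner v u * conjc (cinner v u).
  rewrite -cinner_outer -cinner_mixture !cinner_apply big_distrr -sumrB; apply: eq_bigr => x _.
  rewrite big_distrr -sumrB; apply: eq_bigr => y _ /=; ring.
move=> /psdE le; apply/psdE => v; rewrite E cinner_sandwich.
under eq_bigr do rewrite cinner_sandwich.
by rewrite -E; exact: le.
Qed.

End Transport.

(** * Indices of the block space and its dimension *)

Section BlockIndex.
Variables (R : realType) (k : nat) (dAi dRi : 'I_k -> nat).
Local Notation C := R[i].
Local Notation idxA := {i : 'I_k & 'I_(dAi i)}.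
Local Notation idxR := {i : 'I_k & 'I_(dRi i)}.

Definition Vleft (j : Vidx dAi dRi) : idxA := Tagged (fun i => 'I_(dAi i)) (tagged j).1.
Definition Vright (j : Vidx dAi dRi) : idxR := Tagged (fun i => 'I_(dRi i)) (tagged j).2.

Lemma sum_Vidx (F : idxA -> idxR -> C) : (forall a r, tag a != tag r -> F a r = 0) ->
  \sum_a \sum_r F a r = \sum_j F (Vleft j) (Vright j).
Proof.
move=> F0.
have sumA (T : 'I_k -> finType) (G : {i : 'I_k & T i} -> C) :
    \sum_a G a = \sum_i \sum_(p : T i) G (Tagged T p).
  by rewrite sig_big_dep; apply: eq_bigr => -[].
rewrite (sumA (fun i => 'I_(dAi i))) (sumA (fun i => ('I_(dAi i) * 'I_(dRi i))%type)).
apply: eq_bigr => i _.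
rewrite -(pair_bigA _ (fun p q => F (Tagged (fun i => 'I_(dAi i)) p) (Tagged (fun i => 'I_(dRi i)) q))).
apply: eq_bigr => p _ /=; rewrite (sumA (fun i => 'I_(dRi i))) (bigD1 i)//= [X in _ + X]big1 ?addr0//.
by move=> i' ii'; rewrite big1// => q _; rewrite F0// eq_sym.
Qed.

(** Identifies the number of matching pairs with the dimension x. The count is taken in [C] so that
    [sum_Vidx] applies to the indicator. *)
Lemma card_same_tag :
  #|[pred z : idxA * idxR | tag z.1 == tag z.2]| = (\sum_i dAi i * dRi i)%N.
Proof.
transitivity #|{: Vidx dAi dRi}|; last first.
  rewrite card_tagged sumnE big_map big_enum; apply: eq_bigr => i _.
  by rewrite card_prod !card_ord.
apply/eqP; rewrite -(@eqr_nat C); apply/eqP.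
rewrite -sum1_card natr_sum big_mkcond /=.
rewrite -(pair_bigA _ (fun (a : idxA) (r : idxR) => if tag a == tag r then 1%:R else 0)) /=.
rewrite sum_Vidx => [|a r /negbTE ->//].
rewrite -sum1_card natr_sum; apply: eq_bigr => j _.
by rewrite /Vleft /Vright /= eqxx.
Qed.

End BlockIndex.

(** * Assembly: coordinates of the given purification and the resulting measure *)

Theorem theorem2 (R : realType) (dA dR k n : nat) (dAi dRi : 'I_k -> nat)
  (sigma : 'I_dA -> 'I_dA -> R[i])
  (eA : {i : 'I_k & 'I_(dAi i)} -> 'I_dA -> R[i])
  (eR : {i : 'I_k & 'I_(dRi i)} -> 'I_dR -> R[i])
  (rho : {ffun 'I_n -> 'I_dA} * {ffun 'I_n -> 'I_dR} ->
         {ffun 'I_n -> 'I_dA} * {ffun 'I_n -> 'I_dR} -> R[i]) :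
  (0 < n)%N ->
  psd sigma ->
  orthonormal_fam eA -> orthonormal_fam eR ->
  purification (tpow_op n sigma) rho ->
  supported_on rho (inSymV eA eR n) ->
  exists (d : measure_display) (T : measurableType d) (P : probability T R)
         (phi : T -> 'I_dA * 'I_dR -> R[i]),
    [/\ (forall z, measurable_fun setT (fun t => @complex.Re R (phi t z)) /\
                   measurable_fun setT (fun t => @complex.Im R (phi t z))),
        (forall t, inV eA eR (phi t) /\ purification sigma (outer (phi t))) &
        loewner_le rho
          (fun X Y => ('C(n + (\sum_i dAi i * dRi i) - 1, n))%:R *
                      op_integral P (fun t => tpow_outer n (phi t)) X Y)].
Proof.
move=> n0 psig oA oR [prho rrho trho] srho.
have [psi [v [rhoE [psiE [x0 psi0]]]]] := psd_rank1 prho rrho.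
pose Psi a r := psi (a, r).
have PsiPsi : kmul Psi (kadj Psi) = tpow sigma by rewrite -[RHS]/(tpow_op n sigma) -trho rhoE.
(* The indices are arranged so that P^* P = 1 and Q Q^* = 1: the block coordinates sit between [P]
   on the left and [Q] on the right. *)
pose P x a := eA a x; pose Q := eR.
have PP : kmul (kadj P) P = kid R (X := _) by apply: kerP => a a'; exact: oA.
have QQ : kmul Q (kadj Q) = kid R (X := _).
  apply: kerP => r r'; rewrite /kid -[RHS]conjc_nat -(oR r r') rmorph_sum.
  by apply: eq_bigr => x _; rewrite rmorphM /= conjcK.
have [[c0 c0E] psis] : inSymV eA eR n psi by rewrite psiE; exact: srho.
have psiX a r : psi (a, r) = \sum_js c0 js * \prod_m Vbasis eA eR (js m) (a m, r m).
  have := congr1 (fun F => F [ffun m => (a m, r m)]) c0E => /=.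
  rewrite (_ : [ffun _ => _] = a); last by apply/ffunP => m; rewrite !ffunE.
  rewrite (_ : [ffun _ => _] = r); last by apply/ffunP => m; rewrite !ffunE.
  by move=> ->; apply: eq_bigr => js _; under eq_bigr do rewrite ffunE.
pose c (a : {ffun 'I_n -> {i : 'I_k & 'I_(dAi i)}}) (r : {ffun 'I_n -> {i : 'I_k & 'I_(dRi i)}}) :=
  \sum_js c0 js * (kid R [ffun m => Vleft (js m)] a * kid R [ffun m => Vright (js m)] r).
have PsiE : Psi = kmul (tpow P) (kmul c (tpow Q)).
  apply: kerP => a r; rewrite /Psi psiX.
  transitivity (\sum_js c0 js * (\sum_a' kid R [ffun m => Vleft (js m)] a' * tpow P a a') *
      (\sum_r' kid R [ffun m => Vright (js m)] r' * tpow Q r' r)).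
    apply: eq_bigr => js _; rewrite !sum_eq1l -mulrA; congr (_ * _).
    by rewrite /tpow -big_split; apply: eq_bigr => m _; rewrite !ffunE.
  rewrite /kmul.
  under [RHS]eq_bigr do rewrite big_distrr.
  under [RHS]eq_bigr do under eq_bigr do rewrite /c big_distrl big_distrr.
  under [RHS]eq_bigr do rewrite exchange_big.
  rewrite [RHS]exchange_big; apply: eq_bigr => js _.
  rewrite -mulrA big_distrlr big_distrr; apply: eq_bigr => a' _.
  rewrite big_distrr; apply: eq_bigr => r' _ /=; ring.
(* [c] is recovered from [Psi], and so inherits its permutation symmetry, which the chosen
   coefficients [c0] do not display. *)
have cE : c = kmul (tpow (kadj P)) (kmul Psi (tpow (kadj Q))).
  by rewrite PsiE -!kmulA -tpowM QQ tpow1 kmul1r kmulA -tpowM PP tpow1 kmul1l.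
have Psis : kequiv Psi.
  move=> s a r; have := psis s [ffun m => (a m, r m)] => /= e.
  rewrite /Psi; move: e; congr (psi (_, _) = psi (_, _)); apply/ffunP => m; by rewrite !ffunE.
have cs : kequiv c.
  by rewrite cE; apply: kmul_equiv (tpow_equiv _) _; apply: kmul_equiv (tpow_equiv _).
have cb (a : {ffun 'I_n -> {i : 'I_k & 'I_(dAi i)}}) (r : {ffun 'I_n -> {i : 'I_k & 'I_(dRi i)}}) m :
    tag (a m) != tag (r m) -> c a r = 0.
  move=> ar; rewrite /c big1// => js _; rewrite /kid.
  have [e|_] := eqVneq [ffun m => Vleft (js m)] a; last by rewrite mul0r mulr0.
  have [e'|_] := eqVneq [ffun m => Vright (js m)] r; last by rewrite mulr0 mulr0.
  by move: ar; rewrite -e -e' !ffunE eqxx.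
have PccP : kmul (tpow P) (kmul (kmul c (kadj c)) (tpow (kadj P))) = tpow sigma.
  rewrite -PsiPsi PsiE !kadjM -!tpow_adj -!kmulA.
  by rewrite [kmul (tpow Q) _]kmulA -tpowM QQ tpow1 kmul1l.
pose s := kmul (kadj P) (kmul sigma P).
have cc : kmul c (kadj c) = tpow s.
  rewrite /s !tpowM -PccP -!kmulA -tpowM PP tpow1 kmul1r.
  by rewrite kmulA -tpowM PP tpow1 kmul1l.
have ps : psd s.
  by have := psd_conjugate (kadj P) psig; rewrite kadjK.
(* At constant tuples the tensor power is [s a a' ^+ n], while every term of the sum over [r]
   vanishes: the tag of its first slot cannot equal both [tag a] and [tag a']. *)
have sb a a' : tag a != tag a' -> s a a' = 0.
  move=> aa'; have := congr1 (fun K => K [ffun=> a] [ffun=> a']) cc.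
  rewrite /tpow; under [X in _ = X -> _]eq_bigr do rewrite !ffunE.
  rewrite prodr_const card_ord /kmul big1 => [/esym/eqP|r _].
    by rewrite expf_eq0 n0 => /eqP.
  have [e|ne] := eqVneq (tag a) (tag (r (Ordinal n0))).
    by rewrite /kadj (cb [ffun=> a'] r (Ordinal n0)) ?ffunE -?e 1?eq_sym// conjc0 mulr0.
  by rewrite (cb _ r (Ordinal n0)) ?ffunE// mul0r.
(* [sigma] has no part outside the range of [P], since P s P^* has the same n-th tensor power. *)
have sigmaE : kmul P (kmul s (kadj P)) = sigma.
  apply: (tpow_psd_inj n0 (psd_conjugate P ps) psig).
  by rewrite tpowM [tpow (kmul s _)]tpowM -cc PccP.
have [b [y [bb yb bbs byb ybh]]] := block_factorization n0 ps sb cb cc.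
have byc : kmul (tpow (kmul b y)) c = c.
  apply: kmul_fix; rewrite cc -tpowM; congr tpow.
  by rewrite -bbs kmulA -[kmul (kmul b y) b]kmulA byb.
have ccb : kmul c (kadj c) = tpow (kmul b (kadj b)) by rewrite bbs.
have [m [p [V [p0 p1 VU le]]]] := symmetric_purification_le n0 bb yb cs cb byb ybh byc ccb.
case: m p V p0 p1 VU le => [|m] p V p0 p1 VU le.
  by move: p1; rewrite big_ord0 => /eqP; rewrite eq_sym oner_eq0.
(* [inord] sends every natural number to a valid index, so [phi t] below is a purification of
   [sigma] for all t, while the measure charges only t < m.+1. *)
pose pn t : {nonneg R} := NngNum (p0 (inord t)).
have pn1 : \sum_(j < m.+1) (pn j)%:num = 1.
  by rewrite -p1; apply: eq_bigr => j _; rewrite /= inord_val.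
pose Phi (t : nat) := kmul P (kmul (kmul b (V (inord t))) Q).
pose phi t z := Phi t z.1 z.2.
exists _, nat, (dirac_mix pn1), phi; split.
- by move=> z; split.
- move=> t; have [bV uV] := VU (inord t); split.
    exists (fun j => kmul b (V (inord t)) (Vleft j) (Vright j)); apply/funext => z.
    rewrite /phi /Phi /kmul.
    under eq_bigr do rewrite big_distrr.
    rewrite sum_Vidx => [|a r ar].
      by apply: eq_bigr => j _; rewrite /Vbasis /P /Q /=; ring.
    rewrite /= big1 ?mul0r ?mulr0// => q _.
    have [e|ne] := eqVneq (tag a) (tag q); last by rewrite bb ?mul0r.
    by rewrite bV ?mulr0// -e.
  have tr : ptrace2 (outer (phi t)) = sigma.
    rewrite -[LHS]/(kmul (Phi t) (kadj (Phi t))) /Phi !kadjM -!kmulA.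
    rewrite [kmul Q _]kmulA QQ kmul1l [kmul (V _) _]kmulA (kmul1C uV) kmul1l.
    by rewrite [kmul b _]kmulA bbs sigmaE.
  split; [exact: psd_outer| |exact: tr].
  (* Rank one requires a nonzero vector: if [phi t] vanished, [sigma] would be 0, hence Psi Psi^* =
     0 and [psi] = 0. *)
  have [/existsP[z]|] := boolP [exists z, phi t z != 0]; first exact: rank_outer.
  rewrite negb_exists => /forallP phi0; exfalso.
  have sig0 a a' : sigma a a' = 0.
    rewrite -tr /ptrace2 big1// => r _; rewrite /outer.
    by move: (phi0 (a, r)); rewrite negbK => /eqP ->; rewrite mul0r.
  case: x0 psi0 => a r /eqP; apply.
  apply: (kmul_adj_eq0 (F := Psi)); rewrite PsiPsi /tpow (bigD1 (Ordinal n0))//=.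
  by rewrite sig0 mul0r.
- have -> : (fun X Y => 'C(n + (\sum_i dAi i * dRi i) - 1, n)%:R *
      op_integral (dirac_mix pn1) (fun t => tpow_outer n (phi t)) X Y) =
    fun X Y => 'C(n + (\sum_i dAi i * dRi i) - 1, n)%:R *
      mixture (fun j => (p j)%:C%C)
        (fun j (X : {ffun 'I_n -> 'I_dA} * {ffun 'I_n -> 'I_dR}) =>
           kmul (tpow P) (kmul (tpow (kmul b (V j))) (tpow Q)) X.1 X.2) X Y.
    apply: kerP => X Y; congr (_ * _); rewrite /op_integral !Rintegral_dirac_mix.
    have tE (j : 'I_m.+1) : tpow_outer n (phi j) X Y =
        outer (fun X : {ffun 'I_n -> 'I_dA} * {ffun 'I_n -> 'I_dR} =>
          kmul (tpow P) (kmul (tpow (kmul b (V j))) (tpow Q)) X.1 X.2) X Y.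
      by rewrite (@tpow_outerE _ _ _ n (Phi j))// /Phi inord_val -!tpowM.
    apply/eqP; rewrite eq_complex /= Re_sum Im_sum; apply/andP; split; apply/eqP.
      by apply: eq_bigr => j _; rewrite tE ReZ inord_val.
    by apply: eq_bigr => j _; rewrite tE ImZ inord_val.
  rewrite rhoE (_ : psi = fun x => kmul (tpow P) (kmul c (tpow Q)) x.1 x.2); last first.
    by apply/funext => -[a r]; rewrite -PsiE.
  by apply: loewner_sandwich; rewrite -card_same_tag.
Qed.
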